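(* Let $p$ be a prime, let $a$ be an integer not divisible by $p$ and let $F$ be a natural number divisible by $p$. Define $r$ by $|F|_p=p^{-r}$. Suppose that $$\log F+\sum_{q\mid F}\frac{\log q}{q-1}+\frac32<2r\log p+2\,\frac{\log p}{p-1},$$ where the sum is over all primes $q$ dividing $F$. Then the $p$-adic number $T_p(a/F)$ is irrational, i.e. $T_p(a/F)\in\mathbb{Q}_p\setminus\mathbb{Q}$.
   Context: The Bernoulli numbers $B_n$ are defined by $\frac{t}{e^t-1}=\sum_{n\ge0}B_n\frac{t^n}{n!}$. For a prime $p$, an integer $a$ with $p\nmid a$ and a positive integer $F$ with $p\mid F$, the $p$-adic number $T_p(a/F)$ is the sum of the $p$-adically convergent series $$T_p(a/F)=\sum_{n\ge0}(n+1)B_n\left(-\frac{F}{a}\right)^{n+2}\in\mathbb{Q}_p .$$ $|\cdot|_p$ is the $p$-adic absolute value normalized by $|p|_p=1/p$. *)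

(* Defs.v *)
From HB Require Import structures.
From mathcomp Require Import all_boot all_order all_algebra.
From mathcomp Require Import lra ring.
From mathcomp Require Import boolp classical_sets functions filter reals.
From mathcomp Require Import topology sequences exp.

Set Implicit Arguments.
Unset Strict Implicit.
Unset Printing Implicit Defensive.

Import Order.TTheory GRing.Theory Num.Theory.

Local Open Scope classical_set_scope.
Local Open Scope quotient_scope.
Local Open Scope ring_scope.

(* A formal power series over a field is the sequence of its coefficients.    *)
Section FormalPowerSeries.
Variable K : fieldType.
Implicit Types f g : nat -> K.

Definition fps_mul f g : nat -> K := fun n => \sum_(i < n.+1) f i * g (n - i)%N.

(* The first n coefficients of 1/f, for f with f 0 != 0.                      *)
Fixpoint fps_inv_prefix f (n : nat) : seq K :=
  if n is m.+1 then
    let s := fps_inv_prefix f m in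
    rcons s (if m is 0 then (f 0%N)^-1
             else - (f 0%N)^-1 * \sum_(i < m) s`_i * f (m - i)%N)
  else [::].

Definition fps_inv f : nat -> K := fun n => (fps_inv_prefix f n.+1)`_n.

Lemma size_fps_inv_prefix f n : size (fps_inv_prefix f n) = n.
Proof. by elim: n => //= n IHn; rewrite size_rcons IHn. Qed.

Lemma nth_fps_inv_prefix f n i :
  (i < n)%N -> (fps_inv_prefix f n)`_i = fps_inv f i.
Proof.
elim: n => //= n IHn; rewrite ltnS leq_eqVlt => /orP[/eqP->//|lt_in].
by rewrite nth_rcons size_fps_inv_prefix lt_in IHn.
Qed.

Lemma fps_mul_inv f : f 0%N != 0 ->
  fps_mul (fps_inv f) f =1 (fun n => (n == 0%N)%:R).
Proof.
move=> f0 [|n]; rewrite /fps_mul big_ord_recr /=.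
  by rewrite big_ord0 add0r /fps_inv /= mulVf.
have -> : fps_inv f n.+1 =
    - (f 0%N)^-1 * \sum_(i < n.+1) fps_inv f i * f (n.+1 - i)%N.
  rewrite {1}/fps_inv [fps_inv_prefix f n.+2]/= nth_rcons size_rcons.
  rewrite size_fps_inv_prefix ltnn eqxx; congr (_ * _).
  apply: eq_bigr => i _; congr (_ * _).
  exact: (@nth_fps_inv_prefix f n.+1).
by rewrite subnn mulrAC mulNr mulVf // mulN1r addrN.
Qed.

End FormalPowerSeries.

(* t / (e^t - 1) is the inverse of (e^t - 1) / t = \sum_n t^n / (n+1)!, and   *)
(* its n-th coefficient is B_n / n!; in particular B_1 = -1/2.                *)
Definition bernoulli (n : nat) : rat :=
  n`!%:R * fps_inv (fun k : nat => (k.+1)`!%:R^-1) n.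

(* (\sum_n B_n t^n / n!) * (e^t - 1) = t.                                     *)
Lemma bernoulli_gf :
  fps_mul (fun n => bernoulli n / n`!%:R)
          (fun n => if n is 0 then 0 else n`!%:R^-1)
  =1 (fun n => (n == 1%N)%:R).
Proof.
have E n : bernoulli n / n`!%:R = fps_inv (fun k : nat => (k.+1)`!%:R^-1) n.
  by rewrite /bernoulli mulrAC mulfV ?mul1r // pnatr_eq0 -lt0n fact_gt0.
case=> [|n]; first by rewrite /fps_mul big_ord1 /= mulr0.
have /(_ _ n) := @fps_mul_inv rat (fun k : nat => (k.+1)`!%:R^-1).
rewrite invr1 oner_eq0 eqSS => /(_ isT) <-.
rewrite /fps_mul big_ord_recr /= subnn mulr0 addr0.
by apply: eq_bigr => i _; rewrite E subSn // -ltnS.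
Qed.

Definition padic_val (p : nat) (x : rat) : int :=
  (logn p `|numq x|)%:Z - (logn p `|denq x|)%:Z.

Definition padic_abs (p : nat) (x : rat) : rat :=
  if x == 0 then 0 else p%:R ^ (- padic_val p x).

Section PadicAbs.
Variables (p : nat) (p_pr : prime p).

Let p_gt0 : 0 < p%:R :> rat. Proof. by rewrite ltr0n prime_gt0. Qed.
Let p_neq0 : p%:R != 0 :> rat. Proof. by rewrite lt0r_neq0. Qed.

Lemma padic_val_frac (a b : int) : a != 0 -> b != 0 ->
  padic_val p (a%:~R / b%:~R) = (logn p `|a|)%:Z - (logn p `|b|)%:Z.
Proof.
move=> a0 b0; set x := _ / _.
have b0' : b%:~R != 0 :> rat by rewrite intr_eq0.
have x0 : x != 0 by rewrite mulf_neq0 ?invr_eq0 // intr_eq0.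
have /(congr1 absz) : numq x * b = a * denq x.
  apply: (@intr_inj rat); rewrite !intrM numqE mulrAC.
  by congr (_ * _); rewrite /x divfK.
rewrite !abszM => /(congr1 (logn p)).
rewrite !lognM ?absz_gt0 ?denq_neq0 ?numq_eq0 // /padic_val => E.
by apply/eqP; rewrite subr_eq addrAC eq_sym subr_eq -!PoszD E.
Qed.

Lemma padic_abs0 : padic_abs p 0 = 0.
Proof. by rewrite /padic_abs eqxx. Qed.

Lemma padic_abs_gt0 x : (0 < padic_abs p x) = (x != 0).
Proof.
by rewrite /padic_abs; case: eqP => _; rewrite ?ltxx // exprz_gt0.
Qed.

Lemma padic_abs_ge0 x : 0 <= padic_abs p x.
Proof.
have [->|] := eqVneq x 0; first by rewrite padic_abs0.
by rewrite -padic_abs_gt0 => /ltW.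
Qed.

Lemma padic_abs_eq0 x : (padic_abs p x == 0) = (x == 0).
Proof.
by apply: negb_inj; rewrite -[RHS]padic_abs_gt0 lt_def padic_abs_ge0 andbT.
Qed.

Lemma padic_abs1 : padic_abs p 1 = 1.
Proof.
by rewrite /padic_abs oner_eq0 /padic_val (numq_int 1) (denq_int 1) subrr.
Qed.

Lemma padic_absM x y : padic_abs p (x * y) = padic_abs p x * padic_abs p y.
Proof.
have [->|x0] := eqVneq x 0; first by rewrite !(mul0r, padic_abs0).
have [->|y0] := eqVneq y 0; first by rewrite !(mulr0, padic_abs0).
rewrite /padic_abs mulf_eq0 (negPf x0) (negPf y0) /= -expfzDr //.
congr (_ ^ _).
have -> : x * y = (numq x * numq y)%:~R / (denq x * denq y)%:~R.
  by rewrite -{1}[x]divq_num_den -{1}[y]divq_num_den !intrM invfM mulrACA.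
rewrite padic_val_frac ?mulf_neq0 ?numq_eq0 ?denq_neq0 // !abszM.
rewrite !lognM ?absz_gt0 ?denq_neq0 ?numq_eq0 // /padic_val !PoszD.
ring.
Qed.

Lemma padic_absV x : padic_abs p x^-1 = (padic_abs p x)^-1.
Proof.
have [->|x0] := eqVneq x 0; first by rewrite !(invr0, padic_abs0).
apply: (@mulfI _ (padic_abs p x)); first by rewrite padic_abs_eq0.
by rewrite -padic_absM !mulfV ?padic_abs1 // padic_abs_eq0.
Qed.

Lemma padic_absN x : padic_abs p (- x) = padic_abs p x.
Proof. by rewrite /padic_abs oppr_eq0 /padic_val numqN denqN abszN. Qed.

Lemma padic_abs_distC x y : padic_abs p (x - y) = padic_abs p (y - x).
Proof. by rewrite -opprB padic_absN. Qed.

Let padic_abs_frac (a b : int) : a != 0 -> b != 0 ->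
  padic_abs p (a%:~R / b%:~R) =
  p%:R ^ (- ((logn p `|a|)%:Z - (logn p `|b|)%:Z)).
Proof.
move=> a0 b0; rewrite /padic_abs padic_val_frac //.
by rewrite mulf_eq0 invr_eq0 !intr_eq0 (negPf a0) (negPf b0).
Qed.

Lemma padic_absD x y :
  padic_abs p (x + y) <= Num.max (padic_abs p x) (padic_abs p y).
Proof.
have [->|x0] := eqVneq x 0; first by rewrite add0r le_max lexx orbT.
have [->|y0] := eqVneq y 0; first by rewrite addr0 le_max lexx.
have [->|xy0] := eqVneq (x + y) 0.
  by rewrite padic_abs0 le_max padic_abs_ge0.
pose D := denq x * denq y; pose a := numq x * denq y; pose c := numq y * denq x.
have D0 : D != 0 by rewrite mulf_neq0 ?denq_neq0.
have a0 : a != 0 by rewrite mulf_neq0 ?denq_neq0 ?numq_eq0.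
have c0 : c != 0 by rewrite mulf_neq0 ?denq_neq0 ?numq_eq0.
have D0' : D%:~R != 0 :> rat by rewrite intr_eq0.
have xE : x = a%:~R / D%:~R.
  apply: (mulIf D0'); rewrite mulfVK // !intrM mulrA.
  by rewrite (mulrC x) [_ * x]mulrC -numqE.
have yE : y = c%:~R / D%:~R.
  apply: (mulIf D0'); rewrite mulfVK // !intrM mulrCA mulrC.
  by rewrite -numqE mulrC.
have ac0 : a + c != 0.
  apply: contraNneq xy0 => ac0.
  by rewrite xE yE -mulrDl -intrD ac0 mul0r.
have -> : x + y = (a + c)%:~R / D%:~R by rewrite intrD mulrDl -xE -yE.
rewrite xE yE !padic_abs_frac //.
have p1 : 1 < p%:R :> rat by rewrite ltr1n prime_gt1.
rewrite le_max !ler_eXz2l // !lerN2 !lerD2r !lez_nat -geq_min.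
set m := minn _ _; rewrite -pfactor_dvdn ?absz_gt0 //.
have da : ((p ^ m)%N%:Z %| a)%Z.
  by rewrite dvdzE /= pfactor_dvdn ?absz_gt0 // geq_minl.
have dc : ((p ^ m)%N%:Z %| c)%Z.
  by rewrite dvdzE /= pfactor_dvdn ?absz_gt0 // geq_minr.
by have := rpredD da dc; rewrite dvdzE.
Qed.

Lemma padic_absD_le x y e :
  padic_abs p x <= e -> padic_abs p y <= e -> padic_abs p (x + y) <= e.
Proof. by move=> hx hy; rewrite (le_trans (padic_absD x y)) // ge_max hx hy. Qed.

Lemma padic_absD_lt x y e :
  padic_abs p x < e -> padic_abs p y < e -> padic_abs p (x + y) < e.
Proof. by move=> hx hy; rewrite (le_lt_trans (padic_absD x y)) // gt_max hx hy. Qed.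

Lemma padic_abs_isosceles x y :
  padic_abs p (x - y) < padic_abs p y -> padic_abs p x = padic_abs p y.
Proof.
move=> h; apply/eqP; rewrite eq_le; apply/andP; split.
  by rewrite -[x](subrK y) padic_absD_le // ltW.
rewrite leNgt; apply/negP => h'.
have : padic_abs p (x - (x - y)) < padic_abs p y.
  by rewrite padic_absD_lt // padic_absN.
by rewrite subKr ltxx.
Qed.

End PadicAbs.

Definition padic_cauchy (p : nat) : {pred nat -> rat} := fun u =>
  `[< forall e : rat, 0 < e -> exists N : nat, forall m n : nat,
        (N <= m)%N -> (N <= n)%N -> padic_abs p (u m - u n) < e >].

Definition padic_null_seq (p : nat) (u : nat -> rat) : Prop :=
  forall e : rat, 0 < e -> exists N : nat, forall n : nat,
    (N <= n)%N -> padic_abs p (u n) < e.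

Section PadicCauchy.
Variables (p : nat) (p_pr : prime p).
Implicit Types u v : nat -> rat.

Lemma padic_cauchy_bound u : u \in padic_cauchy p ->
  exists M N, 0 < M /\ forall n, (N <= n)%N -> padic_abs p (u n) <= M.
Proof.
move/asboolP => /(_ 1 ltr01)[N HN]; exists (Num.max 1 (padic_abs p (u N))), N.
split=> [|n le_Nn]; first by rewrite lt_max ltr01.
rewrite -[u n](subrK (u N)) padic_absD_le // le_max.
  by rewrite ltW // HN.
by rewrite lexx orbT.
Qed.

Lemma padic_cauchy_subring : subring_closed (padic_cauchy p).
Proof.
split=> [|u v /asboolP hu /asboolP hv|u v hu hv]; apply/asboolP => e e0.
- by exists 0%N => m n _ _; rewrite subrr padic_abs0.
- have [N1 H1] := hu e e0; have [N2 H2] := hv e e0.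
  exists (maxn N1 N2) => m n; rewrite !geq_max => /andP[? ?] /andP[? ?].
  have -> : (u - v) m - (u - v) n = (u m - u n) + - (v m - v n).
    by rewrite !fctE; ring.
  by rewrite padic_absD_lt ?padic_absN ?H1 ?H2.
have [M1 [K1 [M10 B1]]] := padic_cauchy_bound hu.
have [M2 [K2 [M20 B2]]] := padic_cauchy_bound hv.
move: hu hv => /asboolP hu /asboolP hv.
have [N1 H1] := hu (e / M2) (divr_gt0 e0 M20).
have [N2 H2] := hv (e / M1) (divr_gt0 e0 M10).
exists (maxn (maxn N1 N2) (maxn K1 K2)) => m n; rewrite !geq_max.
move=> /andP[/andP[? ?] /andP[? ?]] /andP[/andP[? ?] /andP[? ?]].
have -> : (u * v) m - (u * v) n = (u m - u n) * v m + u n * (v m - v n).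
  by rewrite !fctE; ring.
rewrite padic_absD_lt // padic_absM //.
  rewrite (@le_lt_trans _ _ (padic_abs p (u m - u n) * M2)) //.
    by rewrite ler_wpM2l ?padic_abs_ge0 ?B2.
  by rewrite -ltr_pdivlMr // H1.
rewrite (@le_lt_trans _ _ (M1 * padic_abs p (v m - v n))) //.
  by rewrite ler_wpM2r ?padic_abs_ge0 ?B1.
by rewrite mulrC -ltr_pdivlMr // H2.
Qed.

Lemma padic_cauchy_neq0 u : u \in padic_cauchy p -> ~ padic_null_seq p u ->
  exists c N, 0 < c /\ forall n, (N <= n)%N -> padic_abs p (u n) = c.
Proof.
move=> /asboolP hu hn.
have [e [e0 He]] : exists e : rat, 0 < e /\
    forall N, exists2 n, (N <= n)%N & e <= padic_abs p (u n).
  apply: contrapT => H; apply: hn => e e0; apply: contrapT => H'.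
  apply: H; exists e; split=> // N; apply: contrapT => H''.
  apply: H'; exists N => n le_Nn; rewrite ltNge; apply/negP => h.
  by apply: H''; exists n.
have [N HN] := hu e e0; have [n0 le_Nn0 en0] := He N.
exists (padic_abs p (u n0)), N; split; first exact: lt_le_trans en0.
by move=> n le_Nn; apply: padic_abs_isosceles => //; apply: lt_le_trans en0; apply: HN.
Qed.

Lemma padic_cauchy_inv u : u \in padic_cauchy p -> ~ padic_null_seq p u ->
  (fun n => (u n)^-1) \in padic_cauchy p.
Proof.
move=> hu hn; have [c [N [c0 Hc]]] := padic_cauchy_neq0 hu hn.
move: hu => /asboolP hu; apply/asboolP => e e0.
have [K HK] := hu (e * c ^+ 2) (mulr_gt0 e0 (exprn_gt0 2 c0)).
exists (maxn N K) => m n; rewrite !geq_max => /andP[Nm Km] /andP[Nn Kn].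
have um0 : u m != 0 by rewrite -(padic_abs_gt0 p_pr) Hc.
have un0 : u n != 0 by rewrite -(padic_abs_gt0 p_pr) Hc.
have -> : (u m)^-1 - (u n)^-1 = (u n - u m) / (u m * u n).
  by field; rewrite um0 un0.
rewrite padic_absM // padic_absV // padic_absM // !Hc // -expr2.
by rewrite ltr_pdivrMr ?exprn_gt0 // HK.
Qed.

End PadicCauchy.

(* The completion of rat for padic_abs p: Cauchy sequences of rationals       *)
(* modulo the ideal of null sequences. The types are indexed by a proof that  *)
(* p is prime so that their ring structures can be canonical.                 *)
Record cauchy_seq (p : nat) (p_pr : prime p) := CauchySeq {
  cauchy_val :> nat -> rat;
  _ : cauchy_val \in padic_cauchy p }.

Section PadicField.
Variables (p : nat) (p_pr : prime p).

HB.instance Definition _ := [isSub for @cauchy_val p p_pr].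
HB.instance Definition _ := [Choice of cauchy_seq p_pr by <:].
HB.instance Definition _ :=
  GRing.SubChoice_isSubComNzRing.Build (nat -> rat) (padic_cauchy p)
    (cauchy_seq p_pr) (padic_cauchy_subring p_pr).

Definition padic_null : {pred cauchy_seq p_pr} :=
  fun u => `[< padic_null_seq p u >].

Lemma padic_null_idealr : idealr_closed padic_null.
Proof.
split=> [||a u v /asboolP hu /asboolP hv].
- by apply/asboolP => e e0; exists 0%N => n _; rewrite padic_abs0.
- apply/asboolP => /(_ 1 ltr01)[N] /(_ N (leqnn N)).
  by rewrite padic_abs1 ltxx.
have [M [K [M0 B]]] := padic_cauchy_bound p_pr (valP a).
apply/asboolP => e e0.
have [N1 H1] := hu (e / M) (divr_gt0 e0 M0); have [N2 H2] := hv e e0.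
exists (maxn K (maxn N1 N2)) => n; rewrite !geq_max => /and3P[? ? ?].
change (padic_abs p (a n * u n + v n) < e).
rewrite padic_absD_lt ?H2 // padic_absM //.
rewrite (@le_lt_trans _ _ (M * padic_abs p (u n))) //.
  by rewrite ler_wpM2r ?padic_abs_ge0 ?B.
by rewrite mulrC -ltr_pdivlMr // H1.
Qed.

HB.instance Definition _ :=
  isIdealr.Build (cauchy_seq p_pr) padic_null padic_null_idealr.

Definition padic : Type := {ideal_quot padic_null}.

HB.instance Definition _ := GRing.ComNzRing.on padic.
HB.instance Definition _ := isPointed.Build padic 0.

Definition padic_class (u : cauchy_seq p_pr) : padic :=
  \pi_({ideal_quot padic_null}) u.

Lemma padic_class_repr (x : padic) : padic_class (repr x) = x.
Proof. exact: reprK. Qed.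

Lemma padic_classB u v : padic_class (u - v) = padic_class u - padic_class v.
Proof. by rewrite /padic_class pi_addr pi_oppr. Qed.

Lemma padic_classD u v : padic_class (u + v) = padic_class u + padic_class v.
Proof. by rewrite /padic_class pi_addr. Qed.

Lemma padic_classM u v : padic_class (u * v) = padic_class u * padic_class v.
Proof. by rewrite /padic_class pi_mulr. Qed.

Lemma padic_class1 : padic_class 1 = 1.
Proof. by rewrite /padic_class pi_oner. Qed.

Lemma padic_class_eq u v :
  padic_class u = padic_class v <-> padic_null_seq p (fun n => u n - v n).
Proof.
have := Quotient.idealrBE padic_null u v.
rewrite /padic_class => E; split=> [/eqP|/asboolP h].
  by rewrite -E => /asboolP.
by apply/eqP; rewrite -E.
Qed.

Lemma padic_class_eq0 u : padic_class u = 0 <-> padic_null_seq p u.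
Proof.
have -> : 0 = padic_class 0 by rewrite /padic_class pi_zeror.
rewrite padic_class_eq; suff -> : (fun n => u n - (0 : cauchy_seq p_pr) n) = u by [].
by apply/funext => n; rewrite subr0.
Qed.

Lemma padic_inv_subproof (x : padic) : x != 0 -> exists y : padic, y * x = 1.
Proof.
rewrite -[x]padic_class_repr; set u := repr x => /eqP.
rewrite padic_class_eq0 => hn.
exists (padic_class (@CauchySeq p p_pr _ (padic_cauchy_inv p_pr (valP u) hn))).
rewrite -padic_classM -padic_class1; apply/padic_class_eq.
have [c [N [c0 Hc]]] := padic_cauchy_neq0 p_pr (valP u) hn.
move=> e e0; exists N => n /Hc cE.
change (padic_abs p ((u n)^-1 * u n - 1) < e).
rewrite mulVf ?subrr ?padic_abs0 //.
by rewrite -(padic_abs_gt0 p_pr) cE.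
Qed.

Definition padic_inv (x : padic) : padic := xget 0 [set y | y * x = 1].

Lemma padic_mulVf (x : padic) : x != 0 -> padic_inv x * x = 1.
Proof.
move=> /padic_inv_subproof[y yx]; rewrite /padic_inv.
by case: xgetP => [z -> //|/(_ y)].
Qed.

Lemma padic_inv0 : padic_inv 0 = 0.
Proof.
rewrite /padic_inv; case: xgetP => // z _ /esym/eqP.
by rewrite mulr0 oner_eq0.
Qed.

HB.instance Definition _ :=
  GRing.ComNzRing_isField.Build padic padic_mulVf padic_inv0.

Let abs_lim (u : nat -> rat) (c : rat) : Prop :=
  forall e : rat, 0 < e -> exists N : nat, forall n : nat,
    (N <= n)%N -> `|padic_abs p (u n) - c| < e.

(* |x|_p is the limit of |u_n|_p for any Cauchy sequence u representing x; it *)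
(* is rational-valued because the value group of padic_abs p is discrete.     *)
Definition padic_norm (x : padic) : rat :=
  xget 0 [set c | forall e : rat, 0 < e -> exists N : nat, forall n : nat,
    (N <= n)%N -> `|padic_abs p (repr x n) - c| < e].

Let abs_lim_uniq u c c' : abs_lim u c -> abs_lim u c' -> c = c'.
Proof.
move=> h h'; apply: contrapT => /eqP cc'.
have e0 : 0 < `|c - c'| / 2 by rewrite divr_gt0 // normr_gt0 subr_eq0.
have [N H] := h _ e0; have [N' H'] := h' _ e0.
have := H _ (leq_maxl N N'); have := H' _ (leq_maxr N N').
set w := padic_abs _ _ => h1 h2.
have := ler_distD w c c'; rewrite (distrC c w); lra.
Qed.

Let abs_lim_null u : padic_null_seq p u -> abs_lim u 0.
Proof.
move=> h e /h[N H]; exists N => n /H.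
by rewrite subr0 ger0_norm ?padic_abs_ge0.
Qed.

Let abs_lim_ex u : u \in padic_cauchy p -> exists c, abs_lim u c.
Proof.
move=> hu; have [/abs_lim_null|hn] := pselect (padic_null_seq p u).
  by exists 0.
have [c [N [c0 Hc]]] := padic_cauchy_neq0 p_pr hu hn.
by exists c => e e0; exists N => n /Hc->; rewrite subrr normr0.
Qed.

Lemma padic_norm_class (u : cauchy_seq p_pr) (e : rat) : 0 < e ->
  exists N : nat, forall n : nat,
    (N <= n)%N -> `|padic_abs p (u n) - padic_norm (padic_class u)| < e.
Proof.
move: e; change (abs_lim u (padic_norm (padic_class u))).
set x := padic_class u; set v := repr x.
have vx : padic_class v = padic_class u by rewrite padic_class_repr.
have hv : abs_lim v (padic_norm x).
  rewrite /padic_norm; case: xgetP => [c -> //|h].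
  by have [c /h] := abs_lim_ex (valP v).
have [ux|/eqP ux] := eqVneq x 0.
  have nu : padic_null_seq p u by apply/padic_class_eq0.
  have nv : padic_null_seq p v by apply/padic_class_eq0; rewrite vx.
  by rewrite (abs_lim_uniq hv (abs_lim_null nv)); apply: abs_lim_null.
have nu : ~ padic_null_seq p u by move/padic_class_eq0.
have [c [N [c0 Hc]]] := padic_cauchy_neq0 p_pr (valP u) nu.
have [K HK] := (padic_class_eq v u).1 vx c c0.
suff -> : padic_norm x = c.
  by move=> e e0; exists N => n /Hc->; rewrite subrr normr0.
apply: (abs_lim_uniq hv) => e e0; exists (maxn N K) => n; rewrite geq_max.
move=> /andP[/Hc un /HK vn].
by rewrite (padic_abs_isosceles p_pr (y := u n)) ?un // subrr normr0.
Qed.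

Lemma padic_norm_unique (u : cauchy_seq p_pr) c :
  abs_lim u c -> padic_norm (padic_class u) = c.
Proof. by move=> h; apply: abs_lim_uniq h; move=> e; apply: padic_norm_class. Qed.

Lemma padic_norm0 : padic_norm 0 = 0.
Proof.
rewrite -[0](padic_class_repr); apply: padic_norm_unique; apply: abs_lim_null.
by apply/padic_class_eq0; rewrite padic_class_repr.
Qed.

Lemma padic_norm_gt0 (x : padic) : x != 0 -> 0 < padic_norm x.
Proof.
rewrite -[x]padic_class_repr; set u := repr x => /eqP.
rewrite padic_class_eq0 => hn.
have [c [N [c0 Hc]]] := padic_cauchy_neq0 p_pr (valP u) hn.
rewrite (@padic_norm_unique _ c) // => e e0.
by exists N => n /Hc->; rewrite subrr normr0.
Qed.

Lemma padic_norm_ge0 (x : padic) : 0 <= padic_norm x.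
Proof. by have [->|/padic_norm_gt0/ltW//] := eqVneq x 0; rewrite padic_norm0. Qed.

Lemma padic_norm_eq0 (x : padic) : padic_norm x = 0 -> x = 0.
Proof.
by move=> h; apply: contrapT => /eqP/padic_norm_gt0; rewrite h ltxx.
Qed.

Lemma padic_normD (x y : padic) :
  padic_norm (x + y) <= Num.max (padic_norm x) (padic_norm y).
Proof.
rewrite -[x]padic_class_repr -[y]padic_class_repr -padic_classD.
set u := repr x; set v := repr y; rewrite leNgt; apply/negP.
have := @padic_norm_class u; have := @padic_norm_class v.
have := @padic_norm_class (u + v).
set a := padic_norm _; set b := padic_norm _; set c := padic_norm _.
move=> hab hb hc; rewrite gt_max => /andP[ca cb].
pose m := Num.max c b.
have ma : m < a by rewrite gt_max ca cb.
have e0 : 0 < (a - m) / 2 by rewrite divr_gt0 ?subr_gt0.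
have [N1 H1] := hab _ e0; have [N2 H2] := hb _ e0; have [N3 H3] := hc _ e0.
pose n := maxn N1 (maxn N2 N3).
have {}H1 := H1 n (leq_maxl _ _).
have {}H2 := H2 n (leq_trans (leq_maxl _ _) (leq_maxr _ _)).
have {}H3 := H3 n (leq_trans (leq_maxr _ _) (leq_maxr _ _)).
have := padic_absD p_pr (u n) (v n).
change (padic_abs p (u n + v n)) with (padic_abs p ((u + v) n)).
have cm : c <= m by rewrite le_max lexx.
have bm : b <= m by rewrite le_max lexx orbT.
by move: H1 H2 H3; rewrite le_max !ltr_norml => ? ? ? /orP[]; lra.
Qed.

Lemma padic_normM (x y : padic) :
  padic_norm (x * y) = padic_norm x * padic_norm y.
Proof.
have [->|x0] := eqVneq x 0; first by rewrite !(mul0r, padic_norm0).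
have [->|y0] := eqVneq y 0; first by rewrite !(mulr0, padic_norm0).
move: x0 y0; rewrite -[x]padic_class_repr -[y]padic_class_repr.
set u := repr x; set v := repr y => /eqP x0 /eqP y0.
rewrite padic_class_eq0 in x0; rewrite padic_class_eq0 in y0.
have [c [N [c0 Hc]]] := padic_cauchy_neq0 p_pr (valP u) x0.
have [d [K [d0 Hd]]] := padic_cauchy_neq0 p_pr (valP v) y0.
rewrite -padic_classM (@padic_norm_unique u c); last first.
  by move=> e e0; exists N => n /Hc->; rewrite subrr normr0.
rewrite (@padic_norm_unique v d); last first.
  by move=> e e0; exists K => n /Hd->; rewrite subrr normr0.
apply: padic_norm_unique => e e0; exists (maxn N K) => n; rewrite geq_max.
move=> /andP[/Hc un /Hd vn].
change ((u * v) n) with (u n * v n).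
by rewrite padic_absM // un vn subrr normr0.
Qed.

Lemma padic_normN (x : padic) : padic_norm (- x) = padic_norm x.
Proof.
have N1 : padic_norm (-1) = 1.
  have n1 : padic_norm 1 = 1.
    have := padic_norm_gt0 (oner_neq0 padic).
    by have /esym := padic_normM 1 1; rewrite mulr1; nra.
  have := padic_norm_ge0 (-1); have := padic_normM (-1) (-1).
  by rewrite mulrNN mulr1 n1; nra.
by rewrite -mulN1r padic_normM N1 mul1r.
Qed.

Definition padic_dist (x y : padic) : rat := padic_norm (x - y).

Lemma padic_distxx x : padic_dist x x = 0.
Proof. by rewrite /padic_dist subrr padic_norm0. Qed.

Lemma padic_dist_eq0 x y : padic_dist x y = 0 -> x = y.
Proof. by move/padic_norm_eq0/eqP; rewrite subr_eq0 => /eqP. Qed.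

Lemma padic_dist_sym x y : padic_dist x y = padic_dist y x.
Proof. by rewrite /padic_dist -opprB padic_normN. Qed.

Lemma padic_dist_triangle y x z :
  padic_dist x z <= padic_dist x y + padic_dist y z.
Proof.
rewrite /padic_dist -(subrKA y) (le_trans (padic_normD _ _)) // ge_max.
by rewrite lerDl lerDr !padic_norm_ge0.
Qed.

HB.instance Definition _ := isMetric.Build rat padic
  padic_distxx padic_dist_eq0 padic_dist_sym padic_dist_triangle.

Lemma padic_const_subproof (q : rat) : (fun=> q) \in padic_cauchy p.
Proof.
by apply/asboolP => e e0; exists 0%N => m n _ _; rewrite subrr padic_abs0.
Qed.

Definition padic_of_rat (q : rat) : padic :=
  padic_class (@CauchySeq p p_pr _ (padic_const_subproof q)).

Let padic_of_rat_eq (u : cauchy_seq p_pr) (q : rat) :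
  (forall n, u n = q) -> padic_class u = padic_of_rat q.
Proof.
by move=> uq; apply/padic_class_eq => e e0; exists 0%N => n _;
  rewrite uq subrr padic_abs0.
Qed.

Lemma padic_of_rat_zmod : zmod_morphism padic_of_rat.
Proof. by move=> x y; rewrite -padic_classB; apply/esym/padic_of_rat_eq. Qed.

Lemma padic_of_rat_monoid : monoid_morphism padic_of_rat.
Proof.
split; first by rewrite -padic_class1; apply/esym/padic_of_rat_eq.
by move=> x y; rewrite -padic_classM; apply/esym/padic_of_rat_eq.
Qed.

HB.instance Definition _ :=
  GRing.isZmodMorphism.Build rat padic padic_of_rat padic_of_rat_zmod.
HB.instance Definition _ :=
  GRing.isMonoidMorphism.Build rat padic padic_of_rat padic_of_rat_monoid.

Lemma padic_of_ratE : padic_of_rat =1 ratr.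
Proof. exact: fmorph_eq_rat. Qed.

Lemma padic_norm_ratr (q : rat) : padic_norm (ratr q) = padic_abs p q.
Proof.
rewrite -padic_of_ratE; apply: padic_norm_unique => e e0.
by exists 0%N => n _; rewrite subrr normr0.
Qed.

Lemma padic_cvgP (u : nat -> padic) (l : padic) :
  u @ \oo --> l <-> forall e : rat, 0 < e ->
    exists N : nat, forall n : nat, (N <= n)%N -> padic_norm (l - u n) < e.
Proof.
have ballE (x y : padic) e : ball x e y = (padic_norm (x - y) < e).
  by rewrite (ballEmdist x e).
split=> [/cvg_ballP h e e0|h].
  by have [N _ H] := h e e0; exists N => n /H /=; rewrite ballE.
by apply/cvg_ballP => e /h[N H]; exists N => // n /= /H; rewrite ballE.
Qed.

Lemma padic_limn_irrational (u : nat -> padic) :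
  ~ (exists x : rat, limn u = ratr x) -> cvgn u.
Proof.
move=> h; apply: contrapT => ncvg; apply: h; exists 0.
rewrite -padic_of_ratE rmorph0 /lim /lim_in /get; apply: xgetPN => x ux.
by apply: ncvg; apply: (@getPex _ [set l | u @ \oo --> l] (ex_intro _ x ux)).
Qed.

End PadicField.

(* The value of limn on divergent sequences is the point 0 of padic p_pr, so  *)
(* by padic_limn_irrational the irrationality of Tp p_pr a F includes the     *)
(* convergence of the series.                                                 *)
Definition Tp (p : nat) (p_pr : prime p) (a : int) (F : nat) : padic p_pr :=
  limn (series (fun n : nat =>
    n.+1%:R * ratr (bernoulli n) * (- (F%:R / a%:~R)) ^+ n.+2 : padic p_pr)).

(* Main.v *)
From HB Require Import structures.
Require Import Defs.
From mathcomp Require Import all_boot all_order all_algebra.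
From mathcomp Require Import lra ring zify.
From mathcomp Require Import boolp classical_sets functions filter reals.
From mathcomp Require Import topology sequences exp.

Set Implicit Arguments.
Unset Strict Implicit.
Unset Printing Implicit Defensive.

Import Order.TTheory GRing.Theory Num.Theory.

Local Open Scope ring_scope.

(** Put x = a/F, so that |x|_p = p^r > 1, and Y = x (1 - x). Write (x)_k for the
    rising factorial and W_k = (x)_k (1-x)_k.

    The formal series T(x) in 1/x, with no constant term, is characterised by
    T(x+1) - T(x) = -2/x^3; it is the asymptotic expansion of the sum of the
    2/(x+k)^3, and it is symmetric under x |-> 1 - x. Solving the same difference
    equation by an inverse factorial series respecting this symmetry gives
      T(x) = - sum_j j!^2 / ((j+1) W_(j+1)),
    and the p-adic sum of the Bernoulli series equals that of the factorial
    series ([Tfact_cvg_rational]). On the level of coefficients this is a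
    statement on the linear functional u^m |-> m (-1)^(m-1) B_(m-1) on
    polynomials, whose value at P is a combination of the odd central
    differences of P ([Tmoment_stirling]).

    As in Apery's proof for zeta(3), take
      q_n = sum_k (-1)^k C(n,k) C(n+k,k) W_k / k!^2,
      p_n = the same sum with the k-th term multiplied by the k-th partial sum
            of the factorial series.
    Both satisfy the recurrence
      (n+1)^3 u_(n+1) - (2n+1)(n^2+n+1-2Y) u_n + n^3 u_(n-1) = 0,
    and so does the explicit series
      r_n = sum_(j >= n) (-1)^(n+1) j!^4 / ((j-n)! (j+n+1)!) / W_(j+1),
    which therefore equals q_n T - p_n ([null_rem_defect]). Only j >= n
    contributes, so |q_n T - p_n|_p is at most (2n+1) |n!|_p^2 p^(-2rn)
    ([padic_abs_residual]). In the archimedean absolute value the roots of the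
    characteristic equation of the recurrence are both 1, whence p_n and q_n
    grow slower than any exponential ([apery_growth]). A common denominator of
    p_n and q_n is D_n = lcm(1..n)^3 (F^n M_n)^2, where M_n is the part of n!
    composed of the primes of F ([apery_den_int], [apery_num_int]).

    If T were a rational number y = u/v, then N_n = v D_n (q_n y - p_n) would be
    an integer, nonzero for at least one of any two consecutive n because the
    Casoratian of p_n and q_n does not vanish; hence |N_n| |N_n|_p >= 1.
    Dividing the logarithm of this inequality by 2n and letting n grow gives
      2 r log p + 2 log p / (p-1) <= log F + sum_(q | F) log q / (q-1) + 3/2,
    against the hypothesis, provided that for every e > 0 the bound
    log lcm(1..n) <= (1+e) n holds for infinitely many n. This is Chebyshev's
    elementary half of the prime number theorem: if lcm(1..m) exceeded
    exp((1+e) m) for all large m, then the product of the lcm(1..n/k) over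
    k <= n, which divides n!, would exceed n^n for large n
    ([lcm_upto_small]). *)

(** * The Bernoulli functional *)

Lemma bernoulli_rec n :
  \sum_(i < n) 'C(n, i)%:R * bernoulli i = (n == 1%N)%:R.
Proof.
have := bernoulli_gf n; rewrite /fps_mul big_ord_recr /= subnn mulr0 addr0.
move=> /(congr1 (fun z => n`!%:R * z)); rewrite mulr_sumr => E.
transitivity (n`!%:R * (n == 1%N)%:R : rat); last first.
  by case: eqP => [->|_]; rewrite ?mulr1 ?mulr0.
rewrite -E; apply: eq_bigr => i _.
have /prednK <- : (0 < n - i)%N by rewrite subn_gt0.
rewrite prednK ?subn_gt0 //.
have := bin_fact (ltnW (ltn_ord i)) => /(congr1 (fun m => m%:R : rat)) <-.
have f0 m : m`!%:R != 0 :> rat by rewrite pnatr_eq0 -lt0n fact_gt0.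
by rewrite !natrM; field; rewrite !f0.
Qed.

Definition bern_umbra (P : {poly rat}) : rat := \sum_(i < size P) P`_i * bernoulli i.

Lemma bern_umbra_widen (P : {poly rat}) n :
  (size P <= n)%N -> bern_umbra P = \sum_(i < n) P`_i * bernoulli i.
Proof.
move=> le; rewrite /bern_umbra (big_ord_widen n (fun i => P`_i * bernoulli i)) //.
rewrite big_mkcond; apply: eq_bigr => i _; case: ltnP => // h.
by rewrite nth_default // mul0r.
Qed.

Lemma bern_umbra_linear a (P Q : {poly rat}) :
  bern_umbra (a *: P + Q) = a * bern_umbra P + bern_umbra Q.
Proof.
pose n := maxn (size P) (size Q).
have hn : (size (a *: P + Q)%R <= n)%N.
  by rewrite (leq_trans (size_polyD _ _)) // geq_max leq_max size_scale_leq /= leq_maxr.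
rewrite (bern_umbra_widen hn) (bern_umbra_widen (leq_maxl _ _ : (size P <= n)%N)).
rewrite (bern_umbra_widen (leq_maxr _ _ : (size Q <= n)%N)) mulr_sumr -big_split.
by apply: eq_bigr => i _; rewrite coefD coefZ /=; ring.
Qed.

HB.instance Definition _ := GRing.isLinear.Build rat {poly rat} rat *%R bern_umbra
  (fun a P Q => bern_umbra_linear a P Q).

(** On monomials this is the defining recurrence of the Bernoulli numbers. *)
Lemma bern_umbra_shift (P : {poly rat}) :
  bern_umbra (P \Po ('X + 1)) - bern_umbra P = P^`().[0].
Proof.
have mono n : bern_umbra (('X + 1) ^+ n) - bern_umbra 'X^n = (n == 1%N)%:R.
  have -> : ('X + 1) ^+ n = \sum_(i < n.+1) 'C(n, i)%:R *: 'X^i :> {poly rat}.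
    rewrite addrC exprDn; apply: eq_bigr => i _.
    by rewrite expr1n mul1r -scaler_nat.
  have bX i : bern_umbra 'X^i = bernoulli i.
    rewrite (@bern_umbra_widen _ i.+1) ?size_polyXn // big_ord_recr /= coefXn eqxx mul1r.
    by rewrite big1 ?add0r // => j _; rewrite coefXn ltn_eqF ?mul0r.
  rewrite linear_sum big_ord_recr /= linearZ /= binn bX mul1r addrK.
  rewrite -bernoulli_rec; apply: eq_bigr => i _.
  by rewrite linearZ /= bX.
have eP : bern_umbra P = bern_umbra (\sum_(i < size P) P`_i *: 'X^i) by rewrite -poly_def coefK.
rewrite comp_polyE eP !linear_sum -sumrB.
transitivity (\sum_(i < size P) P`_i * (i == 1%N :> nat)%:R).
  by apply: eq_bigr => i _; rewrite !linearZ /= -mulrBr mono.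
rewrite horner_coef0 coef_deriv mulr1n.
case: (ltnP 1 (size P)) => h.
  rewrite (bigD1 (Ordinal h)) //= mulr1 big1 ?addr0 // => i.
  by rewrite -val_eqE /= => /negPf ->; rewrite mulr0.
rewrite nth_default // big1 // => i _.
have -> : (i == 1%N :> nat) = false by apply: ltn_eqF; exact: leq_trans (ltn_ord i) h.
by rewrite mulr0.
Qed.

(** The moments of T: as T(x) is the umbral value of 1/(x+t)^2, that is, of the
    derivative of 1/(x-u) at u = -t, the coefficient of x^(-m-1) in T is the
    value of this functional at u^m. *)
Definition Tmoment (P : {poly rat}) : rat := bern_umbra (P^`() \Po - 'X).

Lemma Tmoment_linear a (P Q : {poly rat}) :
  Tmoment (a *: P + Q) = a * Tmoment P + Tmoment Q.
Proof. by rewrite /Tmoment derivD derivZ comp_polyD comp_polyZ linearP. Qed.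

Lemma Tmoment_Xn n : Tmoment 'X^(n.+1) = n.+1%:R * (-1) ^+ n * bernoulli n.
Proof.
rewrite /Tmoment derivXn /= -scaler_nat comp_polyZ comp_Xn_poly.
have -> : (- 'X) ^+ n = ((-1) ^+ n) *: 'X^n :> {poly rat}.
  by rewrite -scaleN1r exprZn.
rewrite !linearZ /= -mulrA; congr (_ * (_ * _)).
rewrite (@bern_umbra_widen _ n.+1) ?size_polyXn // big_ord_recr /= coefXn eqxx mul1r.
by rewrite big1 ?add0r // => j _; rewrite coefXn ltn_eqF ?mul0r.
Qed.

(** The functional form of T(x+1) - T(x) = -2/x^3, since 2/x^3 pairs a
    polynomial with its second derivative at 0. *)
Lemma Tmoment_shift (P : {poly rat}) :
  Tmoment P - Tmoment (P \Po ('X - 1)) = P^`(2).[0].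
Proof.
rewrite /Tmoment deriv_comp derivB derivX derivC subr0 mulr1.
set Q := P^`() \Po - 'X.
have -> : (P^`() \Po ('X - 1)) \Po - 'X = Q \Po ('X + 1).
  rewrite /Q -!comp_polyA; congr (_ \Po _).
  rewrite comp_polyB comp_polyX comp_polyC -[- 'X in RHS]scaleN1r comp_polyZ.
  by rewrite comp_polyX scaleN1r opprD.
rewrite -opprB bern_umbra_shift /Q deriv_comp derivN derivX hornerM !hornerE.
by rewrite horner_comp !hornerE oppr0 mulrN1 opprK.
Qed.

(** * Stirling's formula for the moments of T *)

Fixpoint fdiff (n : nat) (f : rat -> rat) (u : rat) : rat :=
  if n is m.+1 then fdiff m f (u + 1) - fdiff m f u else f u.

Lemma eq_fdiff n f g : f =1 g -> fdiff n f =1 fdiff n g.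
Proof. by move=> fg; elim: n => //= n IH u; rewrite !IH. Qed.

Lemma fdiff_linear n a (f g : rat -> rat) u :
  fdiff n (fun v => a * f v + g v) u = a * fdiff n f u + fdiff n g u.
Proof. by elim: n u => //= n IH u; rewrite !IH; ring. Qed.

(** The falling factorial (X + h)(X + h - 1) ... (X + h - n + 1), on which forward
    differences act like derivatives on powers. *)
Definition ffactp (h : rat) (n : nat) : {poly rat} :=
  \prod_(i < n) ('X + (h - i%:R)%:P).

Lemma ffactp_monic h n : ffactp h n \is monic.
Proof. by apply: monic_prod => i _; rewrite -[_%:P]opprK -polyCN monicXsubC. Qed.

Lemma size_ffactp h n : size (ffactp h n) = n.+1.
Proof.
elim: n => [|n IH]; first by rewrite /ffactp big_ord0 size_poly1.
rewrite /ffactp big_ord_recr /= size_Mmonic ?monic_neq0 ?ffactp_monic //; last first.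
  by rewrite -[_%:P]opprK -polyCN monicXsubC.
by rewrite IH size_XaddC addn2.
Qed.

Lemma ffactpSl h n : ffactp (h + 1) n.+1 = ('X + (h + 1)%:P) * ffactp h n.
Proof.
rewrite /ffactp big_ord_recl subr0; congr (_ * _); apply: eq_bigr => i _.
congr (_ + _%:P); rewrite lift0 -natr1; ring.
Qed.

Lemma ffactpSr h n : ffactp h n.+1 = ffactp h n * ('X + (h - n%:R)%:P).
Proof. by rewrite /ffactp big_ord_recr. Qed.

Lemma ffactp_diff h n : ffactp (h + 1) n.+1 - ffactp h n.+1 = n.+1%:R *: ffactp h n.
Proof.
rewrite ffactpSl ffactpSr mulrC -mulrBr mulrC -mul_polyC; congr (_ * _).
by rewrite opprD addrACA subrr add0r -polyCB; congr (_%:P); rewrite -natr1; ring.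
Qed.

Lemma ffactp_shift h n : ffactp h n \Po ('X - 1) = ffactp (h - 1) n.
Proof.
rewrite /ffactp rmorph_prod /=; apply: eq_bigr => i _.
rewrite comp_polyD comp_polyX comp_polyC -addrA -polyC1 -polyCN -polyCD.
by congr (_ + _%:P); ring.
Qed.

Lemma fdiff_ffactp m h n u :
  fdiff m (horner (ffactp h n)) u = (n ^_ m)%:R * (ffactp h (n - m)).[u].
Proof.
elim: m u => [|m IH] u /=; first by rewrite ffactn0 subn0 mul1r.
rewrite !IH -mulrBr ffactnSr natrM -mulrA; congr (_ * _).
have shift k : (ffactp h k).[u + 1] = (ffactp (h + 1) k).[u].
  rewrite -{1}(addrK 1 h) -ffactp_shift horner_comp; congr _.[_].
  by rewrite !hornerE addrK.
rewrite shift; case E : (n - m)%N => [|k].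
  by rewrite /ffactp !big_ord0 subrr mul0r.
rewrite -hornerN -hornerD ffactp_diff hornerZ; congr (_ * (ffactp _ _).[_]).
by rewrite subnS E.
Qed.

(** A falling factorial is a difference of falling factorials one degree higher,
    so the shift relation of the moments determines its moment. *)
Lemma Tmoment_ffactp h n :
  n.+1%:R * Tmoment (ffactp h n) = 2 * (ffactp (h + 1) n.+1)`_2.
Proof.
have E : Tmoment (ffactp (h + 1) n.+1) =
    n.+1%:R * Tmoment (ffactp h n) + Tmoment (ffactp h n.+1).
  by rewrite -Tmoment_linear -ffactp_diff subrK.
have := Tmoment_shift (ffactp (h + 1) n.+1).
rewrite ffactp_shift addrK E addrK => ->.
by rewrite horner_coef0 coef_derivn /= addn0 -[_`_2 *+ _]mulr_natl.
Qed.
Lemma fdiffS n f u : fdiff n.+1 f u = fdiff n f (u + 1) - fdiff n f u.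
Proof. by []. Qed.

Arguments fdiff : simpl never.

(** Centring the roots at 0 makes the falling factorials even or odd functions of
    the variable, and their second derivative at 0 explicit. *)
Definition central_sq (k : nat) : {poly rat} :=
  \prod_(i < k) ('X^2 - ((i.+1%:R) ^+ 2)%:P).

Lemma ffactp_central k : ffactp k%:R k.*2.+1 = 'X * central_sq k.
Proof.
elim: k => [|k IH]; first by rewrite /ffactp /central_sq big_ord1 big_ord0 subrr addr0 mulr1.
rewrite doubleS -natr1 ffactpSl ffactpSr IH /central_sq big_ord_recr /=.
have -> : k.+1%:R ^+ 2 = (k%:R + 1) * (k%:R + 1) :> rat by rewrite -natr1 expr2.
have -> : k%:R - k.*2.+1%:R = - (k%:R + 1) :> rat by rewrite -natr1 -addnn natrD; ring.
rewrite polyCN polyCM; ring.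
Qed.

Lemma central_sq_coef0 k : (central_sq k)`_0 = (-1) ^+ k * (k`! ^ 2)%N%:R.
Proof.
elim: k => [|k IH]; first by rewrite /central_sq big_ord0 coef1 mulr1.
rewrite -horner_coef0 /central_sq big_ord_recr hornerM horner_coef0 IH.
rewrite !hornerE factS expnMn natrM !natrX. rewrite [(-1) ^+ k.+1]exprS; ring.
Qed.

Lemma central_sq_coef1 k : (central_sq k)`_1 = 0.
Proof.
elim: k => [|k IH]; first by rewrite /central_sq big_ord0 coef1.
rewrite /central_sq big_ord_recr /= -[X in X * _]/(central_sq k) coefM big_ord_recr big_ord1 /=.
by rewrite IH mul0r addr0 !(coefD, coefN, coefXn, coefC) /= subrr mulr0.
Qed.

Lemma Tmoment_ffactp_even k : Tmoment (ffactp (k%:R - 1) k.*2) = 0.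
Proof.
have := Tmoment_ffactp (k%:R - 1) k.*2; rewrite subrK ffactp_central.
rewrite coefXM /= central_sq_coef1 mulr0 => /eqP.
by rewrite mulf_eq0 pnatr_eq0 => /eqP.
Qed.

(** Up to sign the coefficients are those of Stirling's formula for the second
    derivative in terms of even central differences, namely
    2 j!^2 / (2j+2)!, because (j+1) (2j+1)! is half of (2j+2)!. *)
Definition stirling_coef (j : nat) : rat :=
  (-1) ^+ j * (j`! ^ 2)%N%:R / (j.+1%:R * (j.*2.+1)`!%:R).

Lemma fact_neq0 n : n`!%:R != 0 :> rat.
Proof. by rewrite pnatr_eq0 -lt0n fact_gt0. Qed.

Lemma Tmoment_ffactp_odd k :
  Tmoment (ffactp k%:R k.*2.+1) = stirling_coef k * (k.*2.+1)`!%:R.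
Proof.
have E : k.*2.+2%:R * Tmoment (ffactp k%:R k.*2.+1) = 2 * ((-1) ^+ k * (k`! ^ 2)%N%:R).
  rewrite Tmoment_ffactp ffactpSl ffactp_central [('X + _) * _]mulrDl coefD coefXM coefXM coefCM.
  by rewrite coefXM /= central_sq_coef1 mulr0 addr0 central_sq_coef0.
have n0 : k.+1%:R != 0 :> rat by rewrite pnatr_eq0.
have n2 : k.*2.+2%:R = 2 * k.+1%:R :> rat by rewrite -natrM mul2n.
have n20 : k.*2.+2%:R != 0 :> rat by rewrite pnatr_eq0.
apply: (mulfI n20); rewrite E n2 /stirling_coef.
by move: _`!%:R (fact_neq0 k.*2.+1) k.+1%:R n0 => f f0 c c0; field; apply/andP.
Qed.

Definition stirling_sum (J : nat) (f : rat -> rat) : rat :=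
  \sum_(j < J) stirling_coef j * fdiff j.*2.+1 f (- j%:R).

Lemma stirling_sum_linear J a (f g : rat -> rat) :
  stirling_sum J (fun v => a * f v + g v) = a * stirling_sum J f + stirling_sum J g.
Proof.
rewrite /stirling_sum mulr_sumr -big_split; apply: eq_bigr => j _.
by rewrite fdiff_linear mulrDr [in LHS]mulrCA.
Qed.

Lemma eq_stirling_sum J f g : f =1 g -> stirling_sum J f = stirling_sum J g.
Proof. by move=> fg; apply: eq_bigr => j _; rewrite (eq_fdiff _ fg). Qed.

Lemma ffactp_root h n i : (i < n)%N -> (ffactp h n).[i%:R - h] = 0.
Proof.
move=> lt; apply/eqP; rewrite /ffactp horner_prod.
by rewrite (bigD1 (Ordinal lt)) //= !hornerE mulf_eq0 /=; apply/orP; left; apply/eqP; ring.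
Qed.

(** The roots are placed as symmetrically as possible about 1/2, the centre of
    the nodes -j, ..., j+1 of the differences in [stirling_sum]: then all these
    differences vanish on the n-th polynomial except the one of order n. *)
Definition ffact_basis n := ffactp (if odd n then n./2%:R else n./2%:R - 1) n.

(** A difference of order less than n is a multiple of a shorter falling factorial
    which still vanishes at the base point, and one of higher order is 0; so only
    the difference of order n survives, when n is odd. *)
Lemma stirling_sum_basis J n : (n <= J.*2)%N ->
  stirling_sum J (horner (ffact_basis n)) = Tmoment (ffact_basis n).
Proof.
rewrite /ffact_basis; have := odd_double_half n; move: n./2 (odd n) => k [] <- le;
  rewrite ?(add0n, add1n) in le *.
  have kJ : (k < J)%N by rewrite -ltn_double.
  rewrite Tmoment_ffactp_odd /stirling_sum (bigD1 (Ordinal kJ)) //= fdiff_ffactp ffactnn subnn.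
  rewrite /ffactp big_ord0 hornerC mulr1 big1 ?addr0 // => j.
  rewrite -val_eqE /= fdiff_ffactp => jk; rewrite subSS -doubleB.
  case: (ltnP j k) => [lt|ge]; last first.
    by rewrite ffact_small ?mul0r ?mulr0 // ltnS ltn_double ltn_neqAle eq_sym jk.
  have -> : - j%:R = (k - j)%N%:R - k%:R :> rat by rewrite natrB ?(ltnW lt) //; ring.
  by rewrite ffactp_root ?mulr0 // -addnn -{1}[(k - j)%N]addn0 ltn_add2l subn_gt0.
rewrite Tmoment_ffactp_even /stirling_sum big1 // => j _; rewrite fdiff_ffactp.
case: (ltnP j k) => [lt|ge]; last first.
  by rewrite ffact_small ?mul0r ?mulr0 // ltnS leq_double.
have -> : - j%:R = (k - j.+1)%N%:R - (k%:R - 1) :> rat.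
  by rewrite natrB // -natr1; ring.
rewrite ffactp_root ?mulr0 //.
rewrite -(subnK lt) doubleD doubleS addnK.
have -> : ((k - j.+1).*2 + j.*2.+2 - j.*2.+1 = (k - j.+1).*2.+1)%N.
  by rewrite -addSnnS addnK.
by rewrite ltnS -addnn leq_addr.
Qed.

(** The coefficientwise form of the inverse factorial expansion of T. Both sides
    are linear and agree on a basis adapted to central differences; the sum may
    be taken as long as desired since high differences kill low degrees. *)
Lemma Tmoment_stirling J (P : {poly rat}) : (size P <= J.*2.+1)%N ->
  Tmoment P = stirling_sum J (horner P).
Proof.
have [m] := ubnP (size P); elim: m => // m IH in P *; rewrite ltnS => Pm PJ.
have [->|P0] := eqVneq P 0.
  rewrite /stirling_sum big1 => [|j _]; last first.
    have -> : fdiff j.*2.+1 (horner 0) (- j%:R) = 0; last by rewrite mulr0.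
    by elim: j.*2.+1 (- j%:R) => [|n IHn] u; rewrite ?fdiffS ?IHn ?subrr // /fdiff horner0.
  by have := Tmoment_linear 1 0 0; rewrite scaler0 addr0; lra.
pose n := (size P).-1.
have Pn : size P = n.+1 by rewrite prednK // lt0n size_poly_eq0.
pose Q := P - lead_coef P *: ffact_basis n.
have lcF : lead_coef (ffact_basis n) = 1 by apply/eqP; apply: ffactp_monic.
have EP : P = lead_coef P *: ffact_basis n + Q by rewrite /Q addrC subrK.
have sQ : (size Q <= n)%N.
  apply/leq_sizeP => i; rewrite leq_eqVlt => /orP[/eqP <-|ni]; rewrite coefB coefZ.
    by move: lcF; rewrite /lead_coef size_ffactp /= => ->; rewrite mulr1 subrr.
  by rewrite (nth_default _ (_ : size P <= i)%N) ?Pn // nth_default ?size_ffactp // mulr0 subrr.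
have TE : Tmoment P = lead_coef P * Tmoment (ffact_basis n) + Tmoment Q.
  by rewrite {1}EP Tmoment_linear.
have Qm : (size Q < m)%N by apply: leq_trans Pm; rewrite Pn ltnS.
have QJ : (size Q <= J.*2.+1)%N by apply: leq_trans (leq_trans sQ _) PJ; rewrite Pn.
rewrite TE (IH _ Qm QJ).
rewrite -(@stirling_sum_basis J); last by rewrite -ltnS -Pn.
rewrite -stirling_sum_linear; apply: eq_stirling_sum => v.
by rewrite -hornerZ -hornerD -EP.
Qed.

Lemma fdiff_inv (x u : rat) n : (forall k : nat, x - u - k%:R != 0) ->
  fdiff n (fun v => (x - v)^-1) u = n`!%:R / \prod_(i < n.+1) (x - u - i%:R).
Proof.
elim: n u => [|n IH] u h; first by rewrite big_ord1 subr0 mul1r.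
have h1 k : x - (u + 1) - k%:R != 0.
  by have := h k.+1; rewrite -natr1; congr (_ != _); ring.
pose A := \prod_(i < n) (x - (u + 1) - i%:R).
have E1 : \prod_(i < n.+1) (x - (u + 1) - i%:R) = A * (x - (u + 1) - n%:R).
  by rewrite big_ord_recr.
have E0 : \prod_(i < n.+1) (x - u - i%:R) = (x - u) * A.
  rewrite big_ord_recl subr0; congr (_ * _); apply: eq_bigr => i _.
  by rewrite lift0 -natr1; ring.
have A0 : A != 0 by apply/prodf_neq0 => i _; apply: h1.
rewrite fdiffS !IH // E1 E0 [in RHS]big_ord_recr /= E0 factS natrM.
have := h 0%N; rewrite subr0 => x0; have := h1 n.
have -> : x - u - n.+1%:R = x - (u + 1) - n%:R by rewrite -natr1; ring.
have -> : n.+1%:R = (x - u) - (x - (u + 1) - n%:R) by rewrite -natr1; ring.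
move: (x - u) x0 (x - (u + 1) - n%:R) => y y0 z z0.
by field; apply/and3P.
Qed.

(** * The inverse factorial series of T *)

(** The Euler integral B(m+1, l+1). The recurrence below reduces it to unit
    fractions, which bounds both its denominator and its p-adic size without
    any analysis of factorials. *)
Definition beta_frac (m l : nat) : rat := m`!%:R * l`!%:R / (m + l).+1`!%:R.

Lemma beta_frac0 m : beta_frac m 0 = m.+1%:R^-1.
Proof.
rewrite /beta_frac addn0 mulr1 factS natrM invfM mulrCA mulfV ?mulr1 //.
exact: fact_neq0.
Qed.

(** Under the integral of t^m (1-t)^l this is the expansion of one factor 1 - t. *)
Lemma beta_fracS m l : beta_frac m l.+1 = beta_frac m l - beta_frac m.+1 l.
Proof.
rewrite /beta_frac addnS addSn !factS !natrM.
have f0 := fact_neq0 (m + l).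
have a0 : (m + l).+1%:R != 0 :> rat by rewrite pnatr_eq0.
have b0 : (m + l).+2%:R != 0 :> rat by rewrite pnatr_eq0.
move: a0 b0; rewrite -[(m + l).+2%:R]natr1 -[(m + l).+1%:R]natr1 natrD.
rewrite -[l.+1%:R]natr1 -[m.+1%:R]natr1 => a0 b0.
by field; rewrite f0 b0 a0.
Qed.

Lemma cube_le_exp n : (n.+1 ^ 3 <= 8 * 2 ^ n)%N.
Proof.
elim: n => // n IH; rewrite (expnS 2) mulnCA.
case: (ltnP n 3) => [|n3]; first by case: n {IH} => [|[|[|]]].
apply: leq_trans (leq_mul (leqnn 2) IH).
rewrite -(subnKC n3); move: (n - 3)%N => m.
by rewrite !expnS expn0; nia.
Qed.

Lemma half_expE M : (2^-1 : rat) ^+ M = (2 ^ M)%N%:R^-1.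
Proof. by rewrite exprVn natrX. Qed.

Lemma sqr_half_exp (M : nat) : M.+1%:R ^+ 2 * 2^-1 ^+ M <= 8 / M.+1%:R :> rat.
Proof.
rewrite half_expE ler_pdivlMr ?ltr0n // mulrAC -exprSr.
rewrite ler_pdivrMr ?ltr0n ?expn_gt0 // -natrX -natrM ler_nat.
exact: cube_le_exp.
Qed.

(** The product (x)_k (1-x)_k; it is a polynomial in x (1-x), see [rpochS_quad]. *)
Definition rpoch (x : rat) (k : nat) : rat :=
  \prod_(i < k) ((x + i%:R) * (1 - x + i%:R)).

Definition Tfact_sum (x : rat) (J : nat) : rat :=
  \sum_(j < J) - ((j`! ^ 2)%N%:R / j.+1%:R / rpoch x j.+1).

Definition Tbern_sum (x : rat) (M : nat) : rat :=
  \sum_(n < M) n.+1%:R * bernoulli n * (- x^-1) ^+ n.+2.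

Lemma rpochS x k : rpoch x k.+1 = rpoch x k * ((x + k%:R) * (1 - x + k%:R)).
Proof. by rewrite /rpoch big_ord_recr. Qed.

Lemma horner_ffactp h n u : (ffactp h n).[u] = \prod_(i < n) (u + h - i%:R).
Proof.
by rewrite /ffactp horner_prod; apply: eq_bigr => i _; rewrite hornerD hornerX hornerC addrA. Qed.

(** The factors are 2k consecutive shifts of x, with k of them negated. *)
Lemma rpoch_ffactp x k : rpoch x k = (-1) ^+ k * (ffactp (k%:R - 1) k.*2).[x].
Proof.
elim: k => [|k IH]; first by rewrite /rpoch /ffactp !big_ord0 hornerC mulr1.
have E : ffactp (k.+1%:R - 1) k.+1.*2 = ffactp (k%:R - 1 + 1) k.*2.+2.
  by rewrite -natr1 addrK subrK.
rewrite rpochS IH E ffactpSl subrK ffactpSr !hornerM !hornerD !hornerX !hornerC.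
by rewrite exprS -addnn natrD; ring.
Qed.

Lemma rpoch_neq0 x k : (forall m : int, x + m%:~R != 0) -> rpoch x k != 0.
Proof.
move=> h; apply/prodf_neq0 => i _; rewrite mulf_neq0 //; first exact: (h i).
rewrite -oppr_eq0; have := h (- (1 + i%:Z)); congr (_ != _).
by rewrite rmorphN rmorphD /=; ring.
Qed.

(** The difference of order 2j+1 of 1/(x-v) over the nodes -j, ..., j+1 is
    (2j+1)! divided by the product of the x - v over these nodes, hence the term
    of index j of the factorial series. *)
Lemma stirling_sum_inv x J : (forall m : int, x + m%:~R != 0) ->
  stirling_sum J (fun v => (x - v)^-1) = Tfact_sum x J.
Proof.
move=> h; apply: eq_bigr => j _; rewrite fdiff_inv => [|k]; last first.
  by have := h (j%:Z - k%:Z); congr (_ != _); rewrite rmorphB /=; ring.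
have -> : \prod_(i < j.*2.+2) (x - - j%:R - i%:R) = (-1) ^+ j.+1 * rpoch x j.+1.
  rewrite rpoch_ffactp mulrA -signr_odd -exprMn mulrNN mulr1 expr1n mul1r.
  by rewrite horner_ffactp -natr1 addrK opprK.
have := rpoch_neq0 j.+1 h; move: (rpoch x j.+1) => w w0.
rewrite /stirling_coef; have := fact_neq0 j.*2.+1; move: _`!%:R => f f0.
have n0 : j.+1%:R != 0 :> rat by rewrite pnatr_eq0.
rewrite exprS; have : (-1) ^+ j != 0 :> rat by rewrite expf_eq0 oppr_eq0 oner_eq0 andbF.
move: (_ ^+ j) j.+1%:R n0 => s n n0 s0.
by field; apply/and4P.
Qed.

(** The Taylor polynomial in v of 1/(x-v); its moment is a partial sum of T. *)
Definition geom_trunc (x : rat) (M : nat) : {poly rat} :=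
  \sum_(m < M) x^-1 ^+ m.+1 *: 'X^m.

Lemma geom_truncE x v M : x != 0 -> x - v != 0 ->
  (x - v)^-1 = (geom_trunc x M).[v] + (v / x) ^+ M / (x - v).
Proof.
move=> x0 xv; elim: M => [|M IH].
  by rewrite /geom_trunc big_ord0 horner0 add0r mul1r.
rewrite /geom_trunc big_ord_recr /= hornerD hornerZ hornerXn {1}IH -addrA; congr (_ + _).
rewrite [x^-1 ^+ M.+1]exprS [(v / x) ^+ M.+1]exprS !exprMn.
by move: (v ^+ M) (x^-1 ^+ M) => a b; field; rewrite x0 xv.
Qed.

Lemma size_geom_trunc x M : (size (geom_trunc x M) <= M)%N.
Proof.
rewrite (leq_trans (size_sum _ _ _)) //; apply/bigmax_leqP => i _.
by rewrite (leq_trans (size_scale_leq _ _)) // size_polyXn.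
Qed.

Lemma Tbern_sum_moment x M : Tbern_sum x M = Tmoment (geom_trunc x M.+1).
Proof.
have TL0 : Tmoment 1 = 0 by rewrite /Tmoment derivC comp_poly0 raddf0.
rewrite /geom_trunc; have -> : Tmoment (\sum_(m < M.+1) x^-1 ^+ m.+1 *: 'X^m) =
    \sum_(m < M.+1) x^-1 ^+ m.+1 * Tmoment 'X^m.
  elim: M.+1 => [|n IH].
    by rewrite !big_ord0; have := Tmoment_linear 1 0 0; rewrite scaler0 addr0; lra.
  by rewrite !big_ord_recr /= addrC Tmoment_linear IH addrC.
rewrite big_ord_recl TL0 mulr0 add0r; apply: eq_bigr => n _.
rewrite lift0 Tmoment_Xn [(- x^-1) ^+ _]exprNn [(-1) ^+ n.+2]exprS [(-1) ^+ n.+1]exprS.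
ring.
Qed.

(** * Convergence of the two series to the same p-adic number *)

Section PadicEstimates.
Variables (p : nat) (p_pr : prime p).

Lemma padic_abs_int (m : int) : padic_abs p m%:~R <= 1.
Proof.
have nat1 (n : nat) : padic_abs p n%:R <= 1.
  elim: n => [|n IH]; first by rewrite padic_abs0.
  by rewrite -natr1 padic_absD_le // padic_abs1.
by case: m => n; rewrite ?NegzE ?rmorphN ?padic_absN; apply: nat1.
Qed.

Lemma padic_abs_nat (n : nat) : padic_abs p n%:R <= 1.
Proof. exact: (padic_abs_int n). Qed.

Lemma padic_absX u n : padic_abs p (u ^+ n) = padic_abs p u ^+ n.
Proof. by elim: n => [|n IH]; rewrite ?padic_abs1 // !exprS padic_absM // IH. Qed.

Lemma padic_abs_sum n (u : nat -> rat) e : 0 <= e ->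
  (forall i, (i < n)%N -> padic_abs p (u i) <= e) ->
  padic_abs p (\sum_(i < n) u i) <= e.
Proof.
move=> e0; elim: n => [|n IH] h; first by rewrite big_ord0 padic_abs0.
rewrite big_ord_recr /= padic_absD_le //; last exact: h.
by apply: IH => i /ltnW; apply: h.
Qed.

Lemma padic_abs_natE n : (0 < n)%N ->
  padic_abs p n%:R = (p ^ logn p n)%N%:R^-1.
Proof.
move=> n0; rewrite /padic_abs pnatr_eq0 -[n == 0%N]negbK -lt0n n0 /=.
have := @padic_val_frac p n 1; rewrite divr1 => -> //; last by rewrite -lt0n.
by rewrite absz1 logn1 subr0 natrX exprnN.
Qed.

(** A power of p dividing n is at most n. *)
Lemma padic_abs_inv_nat n : (0 < n)%N -> padic_abs p n%:R^-1 <= n%:R.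
Proof.
move=> n0; rewrite padic_absV // padic_abs_natE // invrK ler_nat.
by rewrite dvdn_leq // pfactor_dvdnn.
Qed.

(** By [beta_fracS] the fraction is a signed sum of the 1/i with i <= m+l+1. *)
Lemma padic_abs_beta_frac m l : padic_abs p (beta_frac m l) <= (m + l).+1%:R.
Proof.
elim: l m => [|l IH] m; first by rewrite beta_frac0 addn0 padic_abs_inv_nat.
rewrite beta_fracS padic_absD_le // ?padic_absN // addnS.
  by apply: le_trans (IH m) _; rewrite ler_nat.
exact: IH.
Qed.

Lemma padic_abs_fdiff n f u e :
  (forall k : nat, padic_abs p (f (u + k%:R)) <= e) ->
  padic_abs p (fdiff n f u) <= e.
Proof.
elim: n u => [|n IH] u h; first by have := h 0%N; rewrite addr0.
rewrite fdiffS padic_absD_le ?padic_absN ?IH // => k.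
by have := h k.+1; rewrite -natr1 addrA addrAC.
Qed.

Lemma padic_null_of_le (u : nat -> rat) (C : rat) :
  (forall n, padic_abs p (u n) <= C / n.+1%:R) -> padic_null_seq p u.
Proof.
move=> h e e0; exists (Num.truncn (C / e)) => n le.
apply: le_lt_trans (h n) _; rewrite ltr_pdivrMr ?ltr0n // mulrC -ltr_pdivrMr //.
by apply: lt_le_trans (truncnS_gt _) _; rewrite ler_nat.
Qed.

Lemma padic_nullD (u v : nat -> rat) :
  padic_null_seq p u -> padic_null_seq p v -> padic_null_seq p (fun n => u n + v n).
Proof.
move=> hu hv e e0; have [N hN] := hu e e0; have [K hK] := hv e e0.
exists (maxn N K) => n; rewrite geq_max => /andP[nN nK].
by rewrite padic_absD_lt ?hN ?hK.
Qed.

Lemma padic_nullM c u : padic_null_seq p u -> padic_null_seq p (fun n => c * u n).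
Proof.
move=> h e e0; have [c0|c0] := eqVneq c 0.
  by exists 0%N => n _; rewrite c0 mul0r padic_abs0.
rewrite -(padic_abs_gt0 p_pr) in c0; have [N hN] := h _ (divr_gt0 e0 c0).
by exists N => n /hN; rewrite ltr_pdivlMr // -padic_absM // mulrC.
Qed.

Variable x : rat.
Hypothesis x_large : 2 <= padic_abs p x.

Lemma padic_abs_shift (m : int) : padic_abs p (x + m%:~R) = padic_abs p x.
Proof.
apply: (padic_abs_isosceles p_pr).
rewrite [x + _]addrC addrK (le_lt_trans (padic_abs_int _)) //.
by apply: lt_le_trans x_large.
Qed.

Lemma shift_neq0 (m : int) : x + m%:~R != 0.
Proof. by rewrite -(padic_abs_gt0 p_pr) padic_abs_shift (lt_le_trans _ x_large). Qed.

Lemma padic_abs_rpoch k : padic_abs p (rpoch x k) = padic_abs p x ^+ k.*2.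
Proof.
elim: k => [|k IH]; first by rewrite /rpoch big_ord0 padic_abs1.
rewrite rpochS padic_absM // IH doubleS !exprS padic_absM // mulrC -mulrA.
congr (_ * _); first exact: (padic_abs_shift k).
congr (_ * _); rewrite -padic_absN -(padic_abs_shift (- (1 + k%:Z))).
by congr padic_abs; rewrite rmorphN rmorphD /=; ring.
Qed.

(** At integer nodes the Taylor remainder is (v/x)^M / (x-v), and |x|_p >= 2. *)
Lemma padic_abs_geom_err (v : int) M :
  padic_abs p ((x - v%:~R)^-1 - (geom_trunc x M).[v%:~R]) <= 2^-1 ^+ M.
Proof.
have x0 : x != 0 by have := shift_neq0 0; rewrite addr0.
have xv : padic_abs p (x - v%:~R) = padic_abs p x.
  by rewrite -(padic_abs_shift (- v)) rmorphN.
rewrite (@geom_truncE x v%:~R M) //; last by have := shift_neq0 (- v); rewrite rmorphN.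
rewrite addrC addrA [- _ + _]addrC subrr add0r padic_absM // padic_absV // xv.
have xV : (padic_abs p x)^-1 <= 2^-1.
  by rewrite lef_pV2 ?posrE // (lt_le_trans _ x_large).
have xV0 : 0 <= (padic_abs p x)^-1 by rewrite invr_ge0 padic_abs_ge0.
rewrite padic_absX padic_absM // padic_absV //.
apply: (@le_trans _ _ (2^-1 ^+ M * 1)); last by rewrite mulr1.
rewrite ler_pM ?exprn_ge0 ?mulr_ge0 ?padic_abs_ge0 //; last first.
  by apply: le_trans xV _; rewrite invf_le1.
rewrite lerXn2r ?nnegrE ?mulr_ge0 ?padic_abs_ge0 //.
rewrite -[2^-1]mul1r ler_pM ?padic_abs_ge0 //; exact: padic_abs_int.
Qed.

(** The factorials combine into the fraction B(j+1, j+1), so only polynomial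
    growth is left. *)
Lemma padic_abs_stirling_coef j : padic_abs p (stirling_coef j) <= j.+1%:R * j.*2.+1%:R.
Proof.
have -> : stirling_coef j = (-1) ^+ j * (j.+1%:R^-1 * beta_frac j j).
  by rewrite /stirling_coef /beta_frac addnn natrX invfM; ring.
rewrite padic_absM // padic_absX padic_absN padic_abs1 // expr1n mul1r.
rewrite padic_absM // ler_pM ?padic_abs_ge0 ?padic_abs_inv_nat //.
by rewrite -addnn padic_abs_beta_frac.
Qed.

(** The two partial sums apply the same finite difference functional to 1/(x-v)
    and to its Taylor polynomial. *)
Lemma padic_abs_Tfact_bern M :
  padic_abs p (Tfact_sum x M.+1 - Tbern_sum x M) <= 8 / M.+1%:R.
Proof.
rewrite Tbern_sum_moment (@Tmoment_stirling M.+1); last first.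
  by apply: leq_trans (size_geom_trunc _ _) _; rewrite -addnn; lia.
rewrite -stirling_sum_inv; last exact: shift_neq0.
have -> : stirling_sum M.+1 (fun v => (x - v)^-1) -
    stirling_sum M.+1 (horner (geom_trunc x M.+1)) =
    stirling_sum M.+1 (fun v => (x - v)^-1 - (geom_trunc x M.+1).[v]).
  rewrite addrC -[- stirling_sum _ _]mulN1r -stirling_sum_linear; apply: eq_stirling_sum => v.
  by rewrite mulN1r addrC.
apply: le_trans (sqr_half_exp M).
have e0 : 0 <= M.+1%:R ^+ 2 * 2^-1 ^+ M :> rat by rewrite mulr_ge0 ?exprn_ge0.
rewrite /stirling_sum; apply: (padic_abs_sum (u := fun j => stirling_coef j * 
  fdiff j.*2.+1 (fun v => (x - v)^-1 - (geom_trunc x M.+1).[v]) (- j%:R))) => // j jM.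
have -> : M.+1%:R ^+ 2 * 2^-1 ^+ M = (M.+1%:R * (2 * M.+1%:R)) * 2^-1 ^+ M.+1 :> rat.
  by rewrite [2^-1 ^+ M.+1]exprS; field.
rewrite padic_absM // ler_pM ?padic_abs_ge0 //.
  apply: le_trans (padic_abs_stirling_coef j) _; rewrite -!natrM ler_nat leq_mul //.
  by rewrite -addnn; lia.
apply: padic_abs_fdiff => k.
have -> : - j%:R + k%:R = (- j%:Z + k%:Z)%:~R :> rat by rewrite rmorphD rmorphN.
exact: padic_abs_geom_err.
Qed.

Lemma padic_abs_rpochV k : (padic_abs p (rpoch x k))^-1 <= 2^-1 ^+ k.*2.
Proof.
rewrite padic_abs_rpoch -exprVn lerXn2r ?nnegrE ?invr_ge0 ?padic_abs_ge0 //.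
by rewrite lef_pV2 ?posrE // (lt_le_trans _ x_large).
Qed.

Lemma padic_abs_Tfact_step J :
  padic_abs p (Tfact_sum x J.+1 - Tfact_sum x J) <= 8 / J.+1%:R.
Proof.
rewrite /Tfact_sum big_ord_recr /= addrAC subrr add0r padic_absN.
apply: le_trans (sqr_half_exp J).
rewrite padic_absM // padic_absV // padic_absM // expr2.
apply: ler_pM; rewrite ?mulr_ge0 ?invr_ge0 ?padic_abs_ge0 //.
  apply: ler_pM; rewrite ?padic_abs_ge0 ?padic_abs_inv_nat //.
  by apply: le_trans (padic_abs_nat _) _; rewrite ler1n.
apply: le_trans (padic_abs_rpochV _) _.
by rewrite ler_wiXn2l ?invr_ge0 ?invf_le1 // -addnn; lia.
Qed.

Lemma padic_abs_Tfact_tail J k :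
  padic_abs p (Tfact_sum x (J + k) - Tfact_sum x J) <= 8 / J.+1%:R.
Proof.
elim: k => [|k IH]; first by rewrite addn0 subrr padic_abs0 divr_ge0.
rewrite addnS -(subrKA (Tfact_sum x (J + k))) padic_absD_le //.
apply: le_trans (padic_abs_Tfact_step _) _.
by rewrite ler_wpM2l // lef_pV2 ?posrE ?ltr0n // ler_nat ltnS leq_addr.
Qed.

Lemma Tbern_sum_cauchy : Tbern_sum x \in padic_cauchy p.
Proof.
apply/asboolP => e e0; exists (Num.truncn (8 / e)) => m n.
wlog le_mn : m n / (m <= n)%N => [wh Nm Nn|Nm _].
  by case/orP: (leq_total m n) => le; last rewrite padic_abs_distC //; apply: wh.
apply: (@le_lt_trans _ _ (8 / m.+1%:R)); last first.
  rewrite ltr_pdivrMr ?ltr0n // mulrC -ltr_pdivrMr //.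
  by apply: lt_le_trans (truncnS_gt _) _; rewrite ler_nat.
have -> : Tbern_sum x m - Tbern_sum x n = (Tfact_sum x n.+1 - Tbern_sum x n)
   + (- (Tfact_sum x m.+1 - Tbern_sum x m) + (- (Tfact_sum x n.+1 - Tfact_sum x m.+1))) by ring.
have mono k : (m <= k)%N -> 8 / k.+1%:R <= 8 / m.+1%:R :> rat.
  by move=> le; rewrite ler_wpM2l // lef_pV2 ?posrE ?ltr0n // ler_nat.
apply: (padic_absD_le p_pr).
  exact: le_trans (padic_abs_Tfact_bern n) (mono _ le_mn).
apply: (padic_absD_le p_pr); rewrite padic_absN ?padic_abs_Tfact_bern //.
by rewrite -(subnKC le_mn) -addSn (le_trans (padic_abs_Tfact_tail _ _)) // mono.
Qed.

End PadicEstimates.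

Section Limit.
Local Open Scope classical_set_scope.
Variables (p : nat) (p_pr : prime p).

(** The Bernoulli partial sums form a Cauchy sequence, hence define an element of
    the completion, which is their limit; the factorial partial sums are
    asymptotic to them. *)
Lemma Tfact_cvg_rational (a : int) (F : nat) (y : rat) :
  2 <= padic_abs p (a%:~R / F%:R) -> Tp p_pr a F = ratr y ->
  padic_null_seq p (fun J => Tfact_sum (a%:~R / F%:R) J.+1 - y).
Proof.
set x := _ / _ => hx Ty.
pose S := @CauchySeq p p_pr _ (Tbern_sum_cauchy p_pr hx).
have sE M : series (fun n : nat =>
    n.+1%:R * ratr (bernoulli n) * (- (F%:R / a%:~R)) ^+ n.+2 : padic p_pr) M
    = ratr (Tbern_sum x M).
  rewrite /series /= big_mkord -padic_of_ratE /Tbern_sum rmorph_sum.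
  apply: eq_bigr => n _; rewrite rmorphM rmorphM /= rmorph_nat rmorphXn /= rmorphN.
  rewrite padic_of_ratE /x invfM invrK [_^-1 * _]mulrC rmorphM /= fmorphV.
  by rewrite rmorph_int rmorph_nat.
have cvgS : (fun M => ratr (Tbern_sum x M) : padic p_pr) @ \oo --> padic_class S.
  apply/padic_cvgP => e e0.
  have e2 : 0 < e / 2 by rewrite divr_gt0.
  have /asboolP/(_ _ e2)[N hN] := Tbern_sum_cauchy p_pr hx; exists N => n nN.
  rewrite -padic_of_ratE -padic_classB; set D := S - _.
  have [K hK] := padic_norm_class D e2.
  have := hK _ (leq_maxr N K); have := hN _ _ (leq_maxl N K) nN.
  change (D (maxn N K)) with (Tbern_sum x (maxn N K) - Tbern_sum x n).
  set w := padic_abs _ _; rewrite ltr_norml => h1 /andP[h2 _]; lra.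
have TS : Tp p_pr a F = padic_class S.
  by rewrite /Tp (funext sE); apply: (cvg_lim _ cvgS); apply: metric_hausdorff.
rewrite TS -padic_of_ratE in Ty; have /padic_class_eq nul := Ty.
have nul1 : padic_null_seq p (fun J => Tfact_sum x J.+1 - Tbern_sum x J).
  by apply: padic_null_of_le => J; apply: padic_abs_Tfact_bern.
have := padic_nullD p_pr nul1 nul; congr padic_null_seq.
by apply/funext => J /=; rewrite subrKA.
Qed.
End Limit.

(** * Approximations of Apery type and their recurrence *)

(** Up to sign, the coefficients of the shifted Legendre polynomials. *)
Definition legendre_coef (n k : nat) : rat := ('C(n, k) * 'C(n + k, k))%N%:R.

Lemma nat1_neq0 (m : nat) : m%:R + 1 != 0 :> rat.
Proof. by rewrite natr1 pnatr_eq0. Qed.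

Lemma binS_rat n k : (k%:R + 1) * 'C(n, k.+1)%:R = (n%:R - k%:R) * 'C(n, k)%:R :> rat.
Proof.
rewrite natr1 -natrM mul_bin_left natrM; case: (leqP k n) => [le|lt].
  by rewrite natrB.
by rewrite bin_small // !mulr0.
Qed.

(** Lowering n, rather than raising it, makes the division legitimate for every k,
    also beyond the range where the coefficients vanish. *)
Lemma legendre_coefSn n k :
  legendre_coef n k = legendre_coef n.+1 k * (n%:R + 1 - k%:R) / (n%:R + k%:R + 1).
Proof.
rewrite /legendre_coef !natrM.
have n0 := nat1_neq0 n; have nk0 := nat1_neq0 (n + k); rewrite natrD in nk0.
have -> : 'C(n, k)%:R = (n%:R + 1 - k%:R) * 'C(n.+1, k)%:R / (n%:R + 1) :> rat.
  apply: (mulIf n0); rewrite divfK // [LHS]mulrC.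
  have := mul_bin_down n.+1 k; rewrite /= => /(congr1 (fun m => m%:R : rat)).
  rewrite !natrM -natr1 => ->; case: (leqP k n.+1) => [le|lt].
    by rewrite natrB // -natr1.
  by rewrite bin_small // !mulr0.
have -> : 'C(n.+1 + k, k)%:R = (n%:R + k%:R + 1) * 'C(n + k, k)%:R / (n%:R + 1) :> rat.
  apply: (mulIf n0); rewrite divfK // [LHS]mulrC.
  have := mul_bin_down (n.+1 + k) k; rewrite addSn /= => /(congr1 (fun m => m%:R : rat)).
  by rewrite -addSn addnK !natrM -!natr1 natrD => <-.
by field; rewrite n0 nk0.
Qed.

Lemma legendre_coefSk n k :
  legendre_coef n k.+1 =
  legendre_coef n k * (n%:R - k%:R) * (n%:R + k%:R + 1) / (k%:R + 1) ^+ 2.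
Proof.
have k0 := nat1_neq0 k; rewrite /legendre_coef !natrM.
have -> : 'C(n, k.+1)%:R = (n%:R - k%:R) * 'C(n, k)%:R / (k%:R + 1) :> rat.
  by apply: (mulIf k0); rewrite divfK // [LHS]mulrC binS_rat.
have -> : 'C(n + k.+1, k.+1)%:R = (n%:R + k%:R + 1) * 'C(n + k, k)%:R / (k%:R + 1) :> rat.
  apply: (mulIf k0); rewrite divfK // [LHS]mulrC addnS natr1 -natrM -mul_bin_diag.
  by rewrite natrM -natr1 natrD.
by field.
Qed.

Lemma legendre_coef0 n : legendre_coef n 0 = 1.
Proof. by rewrite /legendre_coef !bin0. Qed.

Lemma legendre_coef_small n k : (n < k)%N -> legendre_coef n k = 0.
Proof. by move=> lt; rewrite /legendre_coef bin_small. Qed.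

Section Recurrence.
Variable x : rat.
Let Y : rat := x * (1 - x).

(** The recurrence at index n+1, so that all indices are natural numbers. *)
Definition apery_op (u : nat -> rat) (n : nat) : rat :=
  (n%:R + 2) ^+ 3 * u n.+2
  - (2 * n%:R + 3) * ((n%:R + 1) ^+ 2 + n%:R + 2 - 2 * Y) * u n.+1
  + (n%:R + 1) ^+ 3 * u n.

Definition den_term (n k : nat) : rat :=
  (-1) ^+ k * legendre_coef n k * (rpoch x k / (k`! ^ 2)%N%:R).

(** Zeilberger certificate of the recurrence of the denominators. It is the
    multiple of the (k-1)-st Legendre coefficient forced by comparing the
    coefficients of W_k, with Y W_k = W_(k+1) - k (k+1) W_k. *)
Definition den_cert (n k : nat) : rat :=
  if k is j.+1 then
    2 * (2 * n%:R + 3) * (-1) ^+ j * legendre_coef n.+1 j * (rpoch x k / (j`! ^ 2)%N%:R)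
  else 0.

Lemma rpochS_quad k : rpoch x k.+1 = rpoch x k * (Y + k%:R * (k%:R + 1)).
Proof. by rewrite rpochS /Y; ring. Qed.

Lemma sqr_factS k : (k.+1`! ^ 2)%N%:R = (k%:R + 1) ^+ 2 * (k`! ^ 2)%N%:R :> rat.
Proof. by rewrite factS expnMn natrM natrX natr1. Qed.

Lemma den_term_rec n k : apery_op (den_term ^~ k) n = den_cert n k.+1 - den_cert n k.
Proof.
case: k => [|k]; rewrite /apery_op /den_term /den_cert.
  rewrite !legendre_coef0 rpochS_quad /rpoch big_ord0 fact0 mul0r exp1n !expr0.
  by field.
rewrite ![legendre_coef _ k.+1]legendre_coefSk (legendre_coefSn n k).
rewrite (legendre_coefSn n.+1 k) !rpochS_quad.
rewrite sqr_factS [(-1) ^+ k.+1]exprS -[n.+2%:R]natr1 -[n.+1%:R]natr1 -[k.+1%:R]natr1.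
have k1 := nat1_neq0 k; have nk1 := nat1_neq0 (n + k); have nk2 := nat1_neq0 (n + k).+1.
rewrite -natr1 natrD in nk2; rewrite natrD in nk1.
have f0 : (k`! ^ 2)%N%:R != 0 :> rat by rewrite pnatr_eq0 -lt0n expn_gt0 fact_gt0.
move: (legendre_coef _ _) (rpoch x k) ((k`! ^ 2)%N%:R : rat) f0 ((-1) ^+ k) => a w f f0 s.
move: n%:R k%:R k1 nk1 nk2 => N K k1 nk1 nk2.
by field; rewrite f0 k1 nk1 /= andbT [N + 1 + K]addrAC.
Qed.

Definition apery_den (n : nat) : rat := \sum_(k < n.+1) den_term n k.
Definition apery_num (n : nat) : rat := \sum_(k < n.+1) den_term n k * Tfact_sum x k.

(** The terms with k > n vanish, so the sums for three consecutive n may share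
    one range. *)
Lemma sum_den_term n (u : nat -> rat) d :
  \sum_(k < n.+1) den_term n k * u k = \sum_(k < n.+1 + d) den_term n k * u k.
Proof.
elim: d => [|d IH]; first by rewrite addn0.
rewrite addnS [in RHS]big_ord_recr /= -IH [den_term n (_ + _)]/den_term.
rewrite legendre_coef_small ?leq_addr //.
by rewrite mulr0 !mul0r addr0.
Qed.

Lemma sum_den_term_rec n (u : nat -> rat) :
  apery_op (fun m => \sum_(k < m.+1) den_term m k * u k) n =
  \sum_(k < n.+3) (den_cert n k.+1 - den_cert n k) * u k.
Proof.
rewrite /apery_op (sum_den_term n u 2) (sum_den_term n.+1 u 1) addn2 addn1 !mulr_sumr.
rewrite -sumrB -big_split; apply: eq_bigr => k _ /=.
by rewrite -den_term_rec /apery_op; ring.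
Qed.

Lemma den_cert_small n k : (n.+2 < k)%N -> den_cert n k = 0.
Proof. by case: k => // k h; rewrite /den_cert legendre_coef_small // mulr0 mul0r. Qed.

Lemma apery_den_rec n : apery_op apery_den n = 0.
Proof.
have E m : apery_den m = \sum_(k < m.+1) den_term m k * 1.
  by apply: eq_bigr => k _; rewrite mulr1.
have := sum_den_term_rec n (fun=> 1); rewrite /apery_op -!E => ->.
under eq_bigr do rewrite mulr1.
rewrite -(big_mkord xpredT (fun k => den_cert n k.+1 - den_cert n k)) telescope_sumr //.
by rewrite den_cert_small // subrr.
Qed.

(** The integral over [0, 1] of the shifted Legendre polynomial of degree m, with
    its partial sums in closed form; it vanishes once K exceeds m. *)
Lemma legendre_sum m K : (0 < m)%N ->
  \sum_(k < K) (-1) ^+ k * legendre_coef m k / (k%:R + 1) =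
  - ((-1) ^+ K * legendre_coef m K * K%:R / (m%:R * (m%:R + 1))).
Proof.
move=> m0; have m1 := nat1_neq0 m.
have {}m0 : m%:R != 0 :> rat by rewrite pnatr_eq0 -lt0n.
elim: K => [|K IH]; first by rewrite big_ord0 mulr0 mul0r oppr0.
rewrite big_ord_recr IH /= legendre_coefSk exprS -natr1.
by have K1 := nat1_neq0 K; field; rewrite m0 K1 m1.
Qed.

Hypothesis x_nint : forall m : int, x + m%:~R != 0.

Lemma Tfact_sumS k : Tfact_sum x k.+1 - Tfact_sum x k =
  - ((k`! ^ 2)%N%:R / (k%:R + 1) / rpoch x k.+1).
Proof. by rewrite /Tfact_sum big_ord_recr /= addrAC subrr add0r natr1. Qed.

Lemma sqr_fact_neq0 k : (k`! ^ 2)%N%:R != 0 :> rat.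
Proof. by rewrite pnatr_eq0 -lt0n expn_gt0 fact_gt0. Qed.

(** Summation by parts against the certificate: the factors W cancel, and what is
    left is the integral of a Legendre polynomial of positive degree. *)
Lemma apery_num_rec n : apery_op apery_num n = 0.
Proof.
rewrite sum_den_term_rec.
have parts K : \sum_(k < K) (den_cert n k.+1 - den_cert n k) * Tfact_sum x k =
    den_cert n K * Tfact_sum x K -
    \sum_(k < K) den_cert n k.+1 * (Tfact_sum x k.+1 - Tfact_sum x k).
  elim: K => [|K IH]; first by rewrite !big_ord0 /den_cert mul0r subrr.
  by rewrite !big_ord_recr IH /=; ring.
rewrite parts den_cert_small // mul0r sub0r.
under eq_bigr => k _.
  rewrite Tfact_sumS /den_cert.
  have -> : 2 * (2 * n%:R + 3) * (-1) ^+ k * legendre_coef n.+1 k * (rpoch x k.+1 / (k`! ^ 2)%:R)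
    * - ((k`! ^ 2)%:R / (k%:R + 1) / rpoch x k.+1) =
    - (2 * (2 * n%:R + 3)) * ((-1) ^+ k * legendre_coef n.+1 k / (k%:R + 1)).
    have := rpoch_neq0 k.+1 x_nint; have := sqr_fact_neq0 k; have := nat1_neq0 k.
    move: (rpoch _ _) (_ ^ 2)%N%:R => w f k0 f0 w0; field; rewrite k0 f0 w0 //.
  over.
by rewrite -mulr_sumr legendre_sum // legendre_coef_small // mulr0 !mul0r oppr0 mulr0 oppr0.
Qed.

Lemma den_term0 n : den_term n 0 = 1.
Proof. by rewrite /den_term legendre_coef0 /rpoch big_ord0 fact0 exp1n expr0 divr1 !mulr1. Qed.

Lemma den_term11 : den_term 1 1 = - 2 * Y.
Proof.
rewrite /den_term legendre_coefSk legendre_coef0 rpochS_quad /rpoch big_ord0.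
rewrite sqr_factS fact0 exp1n expr1.
by field.
Qed.

Lemma apery_den0 : apery_den 0 = 1.
Proof. by rewrite /apery_den big_ord1 den_term0. Qed.

Lemma apery_den1 : apery_den 1 = 1 - 2 * Y.
Proof. by rewrite /apery_den big_ord_recr big_ord1 /= den_term0 den_term11 mulNr. Qed.

Lemma apery_num0 : apery_num 0 = 0.
Proof. by rewrite /apery_num big_ord1 /Tfact_sum big_ord0 mulr0. Qed.

Lemma apery_num1 : apery_num 1 = 2.
Proof.
have W1 : rpoch x 1 = Y by rewrite rpochS_quad /rpoch big_ord0 mul1r mul0r addr0.
have Y0 : Y != 0 by rewrite -W1 rpoch_neq0.
rewrite /apery_num big_ord_recr big_ord1 /= den_term11 /Tfact_sum big_ord0 mulr0 add0r big_ord1.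
by rewrite /= W1 fact0 exp1n; field.
Qed.

(** By the recurrence, (n+1)^3 times this expression does not depend on n. *)
Lemma casoratian n :
  apery_den n * apery_num n.+1 - apery_den n.+1 * apery_num n = 2 / (n%:R + 1) ^+ 3.
Proof.
elim: n => [|n IH].
  by rewrite apery_den0 apery_num0 apery_num1 mulr0 subr0 mul1r add0r expr1n divr1.
have n1 := nat1_neq0 n; have n2 := nat1_neq0 n.+1.
have n20 : (n.+1%:R + 1) ^+ 3 != 0 :> rat by rewrite expf_neq0.
apply: (mulIf n20); rewrite divfK //.
have -> : 2 = (n%:R + 1) ^+ 3 * (apery_den n * apery_num n.+1 - apery_den n.+1 * apery_num n).
  by rewrite IH; field.
apply/eqP; rewrite -subr_eq0 -natr1; apply/eqP.
transitivity (apery_den n.+1 * apery_op apery_num n - apery_num n.+1 * apery_op apery_den n).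
  by rewrite /apery_op; ring.
by rewrite apery_den_rec apery_num_rec !mulr0 subrr.
Qed.

(** This is (-1)^(n+1) j!^4 / ((j-n)! (j+n+1)!), written with a binomial coefficient
    so that it vanishes for j < n and its p-adic size is visible. *)
Definition rem_coef (n j : nat) : rat :=
  (-1) ^+ n.+1 * (j`! ^ 2)%N%:R * beta_frac j j * 'C(j.*2.+1, (j + n).+1)%:R.

Definition rem_sum (J n : nat) : rat := \sum_(j < J) rem_coef n j / rpoch x j.+1.

Lemma rem_coefSn n j :
  rem_coef n.+1 j = - rem_coef n j * (j%:R - n%:R) / (j%:R + n%:R + 2).
Proof.
have E1 : (j + n).+1%:R = j%:R + n%:R + 1 :> rat by rewrite -natr1 natrD.
have E2 : j.*2.+1%:R = 2 * j%:R + 1 :> rat by rewrite -natr1 -mul2n natrM.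
have := nat1_neq0 (j + n).+1; have := binS_rat j.*2.+1 (j + n).+1.
rewrite /rem_coef addnS [(-1) ^+ n.+2]exprS E1 E2 -addrA => h h0.
apply: (mulIf h0); rewrite -[2]/(1 + 1) divfK // mulrC; move: h h0.
move: ('C(_, _)%:R : rat) ('C(_, _)%:R : rat) => b c h h0.
transitivity (- (-1) ^+ n.+1 * (j`! ^ 2)%:R * beta_frac j j * ((j%:R + n%:R + (1 + 1)) * c)).
  by ring.
by rewrite h; ring.
Qed.

(** Raising n and j together keeps j - n, which avoids any division by it. *)
Lemma rem_coefSS n j : rem_coef n.+1 j.+1 =
  - rem_coef n j * (j%:R + 1) ^+ 4 / ((j%:R + n%:R + 2) * (j%:R + n%:R + 3)).
Proof.
have E1 : (j + n).+2%:R = j%:R + n%:R + 2 :> rat by rewrite -addn2 !natrD.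
have E2 : (j + n).+3%:R = j%:R + n%:R + 3 :> rat by rewrite -addn3 !natrD.
have E3 : j.*2.+3%:R = 2 * j%:R + 3 :> rat by rewrite -addn3 -mul2n natrD natrM.
have E4 : j.*2.+2%:R = 2 * j%:R + 2 :> rat by rewrite -addn2 -mul2n natrD natrM.
have p1 : j%:R + n%:R + 2 != 0 :> rat by rewrite -E1 pnatr_eq0.
have p2 : j%:R + n%:R + 3 != 0 :> rat by rewrite -E2 pnatr_eq0.
have p3 : 2 * j%:R + 3 != 0 :> rat by rewrite -E3 pnatr_eq0.
have p4 : 2 * j%:R + 2 != 0 :> rat by rewrite -E4 pnatr_eq0.
have bE : 'C(j.*2.+3, (j + n).+3)%:R = (2 * j%:R + 3) * (2 * j%:R + 2) * 'C(j.*2.+1, (j + n).+1)%:R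
    / ((j%:R + n%:R + 2) * (j%:R + n%:R + 3)) :> rat.
  have h1 := mul_bin_diag j.*2.+3 (j + n).+2; have h2 := mul_bin_diag j.*2.+2 (j + n).+1.
  have {}h1 : (2 * j%:R + 3) * 'C(j.*2.+2, (j + n).+2)%:R =
    (j%:R + n%:R + 3) * 'C(j.*2.+3, (j + n).+3)%:R :> rat by rewrite -E3 -E2 -!natrM h1.
  have {}h2 : (2 * j%:R + 2) * 'C(j.*2.+1, (j + n).+1)%:R =
    (j%:R + n%:R + 2) * 'C(j.*2.+2, (j + n).+2)%:R :> rat by rewrite -E4 -E1 -!natrM h2.
  apply: (mulfI p2); rewrite -h1; apply: (mulfI p1); rewrite mulrCA -h2.
  by field; rewrite p1 p2.
have betaE : beta_frac j.+1 j.+1 =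
    beta_frac j j * (j%:R + 1) ^+ 2 / ((2 * j%:R + 2) * (2 * j%:R + 3)).
  rewrite /beta_frac addnS addSn addnn !(factS j) (factS j.*2.+2) (factS j.*2.+1) !natrM.
  rewrite E3 E4 -[j.+1%:R]natr1.
  by field; rewrite p3 p4 !fact_neq0 addrC nat1_neq0.
rewrite /rem_coef doubleS addSn addnS bE betaE sqr_factS [(-1) ^+ n.+2]exprS.
by field; rewrite p1 p2 p3 p4.
Qed.

Lemma rem_coef0 j : rem_coef 0 j = - ((j`! ^ 2)%N%:R / (j%:R + 1)).
Proof.
have f1 := fact_neq0 j; have n1 := nat1_neq0 j; have f2 := fact_neq0 j.*2.+1.
have bE : 'C(j.*2.+1, j.+1)%:R = (j.*2.+1)`!%:R / (j`!%:R * ((j%:R + 1) * j`!%:R)) :> rat.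
  apply: (mulIf (_ : j`!%:R * ((j%:R + 1) * j`!%:R) != 0)).
    by rewrite !mulf_neq0.
  rewrite divfK ?mulf_neq0 //.
  have le : (j.+1 <= j.*2.+1)%N by rewrite ltnS -addnn leq_addr.
  have := bin_fact le; rewrite subSS -addnn addnK addnn => <-.
  by rewrite factS !natrM natr1; ring.
rewrite /rem_coef addn0 bE /beta_frac addnn expr1.
by field; rewrite f1 n1 f2.
Qed.

(** The recurrence holds term by term up to a telescoping difference, because
    Y / W_(j+1) = 1 / W_j - j (j+1) / W_(j+1). The boundary term at j = 0 is absent
    as the coefficients of index n+1 > 0 vanish there. *)
Lemma rem_sum_rec J n :
  apery_op (rem_sum J) n = - (2 * (2 * n%:R + 3) * rem_coef n.+1 J / rpoch x J).
Proof.
elim: J => [|J IH].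
  rewrite /apery_op /rem_sum !big_ord0 /rem_coef bin_small //.
  by rewrite !(mulr0, mul0r, subrr, addr0, oppr0).
have -> : apery_op (rem_sum J.+1) n =
    apery_op (rem_sum J) n + apery_op (fun m => rem_coef m J / rpoch x J.+1) n.
  by rewrite /apery_op /rem_sum !big_ord_recr /=; ring.
rewrite IH /apery_op (rem_coefSn n.+1) rem_coefSS rem_coefSn.
have w0 := rpoch_neq0 J x_nint; have w1 := rpoch_neq0 J.+1 x_nint.
rewrite rpochS_quad in w1 *; have w2 : Y + J%:R * (J%:R + 1) != 0.
  by apply: contraNneq w1 => ->; rewrite mulr0.
have p1 : J%:R + n%:R + 2 != 0 :> rat by rewrite -natrD -natrD pnatr_eq0 addnS.
have p2 : J%:R + n%:R + 3 != 0 :> rat by rewrite -natrD -natrD pnatr_eq0 addnS.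
rewrite -[n.+1%:R]natr1; have -> : J%:R + (n%:R + 1) + 2 = J%:R + n%:R + 3 :> rat by ring.
by field; rewrite w0 w2 p1 p2.
Qed.

Lemma rem_sum0 J : rem_sum J 0 = Tfact_sum x J.
Proof. by apply: eq_bigr => j _; rewrite rem_coef0 mulNr natr1. Qed.

(** Here the boundary term at j = 0 does not vanish: it is the numerator p_1 = 2. *)
Lemma rem_sum1 J :
  rem_sum J 1 = (1 - 2 * Y) * rem_sum J 0 - 2 - 2 * rem_coef 0 J / rpoch x J.
Proof.
elim: J => [|J IH].
  by rewrite /rem_sum !big_ord0 rem_coef0 /rpoch big_ord0 fact0 exp1n; field.
rewrite /rem_sum !big_ord_recr /= -!/(rem_sum J _) IH rem_coefSn !rem_coef0 sqr_factS.
have w0 := rpoch_neq0 J x_nint; have w1 := rpoch_neq0 J.+1 x_nint.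
rewrite rpochS_quad in w1 *; have w2 : Y + J%:R * (J%:R + 1) != 0.
  by apply: contraNneq w1 => ->; rewrite mulr0.
have p1 : J%:R + 1 != 0 :> rat := nat1_neq0 J.
have p2 := nat1_neq0 J.+1; rewrite -natr1 in p2 *.
have -> : J%:R + 0 + 2 = J%:R + 1 + 1 :> rat by ring.
by field; rewrite w0 w2 p1 p2.
Qed.

Definition rem_defect (J n : nat) : rat :=
  apery_den n * Tfact_sum x J - apery_num n - rem_sum J n.

Lemma rem_defect0 J : rem_defect J 0 = 0.
Proof. by rewrite /rem_defect apery_den0 apery_num0 rem_sum0 mul1r subr0 subrr. Qed.

Lemma rem_defect1 J : rem_defect J 1 = 2 * rem_coef 0 J / rpoch x J.
Proof. by rewrite /rem_defect apery_den1 apery_num1 rem_sum1 rem_sum0; ring. Qed.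

Lemma rem_defect_rec J n :
  apery_op (rem_defect J) n = 2 * (2 * n%:R + 3) * rem_coef n.+1 J / rpoch x J.
Proof.
transitivity (Tfact_sum x J * apery_op apery_den n - apery_op apery_num n - apery_op (rem_sum J) n).
  by rewrite /apery_op /rem_defect; ring.
by rewrite apery_den_rec apery_num_rec rem_sum_rec mulr0 !sub0r opprK.
Qed.

End Recurrence.

(** * The p-adic size of the remainder *)

Definition residual (x y : rat) (n : nat) : rat := apery_den x n * y - apery_num x n.

Section Remainder.
Variables (p : nat) (p_pr : prime p) (x : rat).
Hypothesis x_large : 2 <= padic_abs p x.

Let x_nint := shift_neq0 p_pr x_large.

(** The coefficient is j!^2 times the fraction B(j+1, j+1) times an integer. *)
Lemma padic_abs_rem_coef n j :
  padic_abs p (rem_coef n j) <= j.*2.+1%:R * padic_abs p j`!%:R ^+ 2.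
Proof.
rewrite /rem_coef natrX 3!(padic_absM p_pr) !padic_absX // padic_absN padic_abs1 //.
have hb := padic_abs_beta_frac p_pr j j; rewrite addnn in hb.
rewrite expr1n mul1r [leRHS]mulrC -[leRHS]mulr1.
apply: ler_pM; rewrite ?mulr_ge0 ?exprn_ge0 ?padic_abs_ge0 ?padic_abs_nat //.
by rewrite ler_wpM2l ?exprn_ge0 ?padic_abs_ge0.
Qed.

Lemma padic_abs_fact_le n j : (n <= j)%N ->
  padic_abs p j`!%:R <= padic_abs p n`!%:R.
Proof.
move=> le; have := bin_fact le => <-.
rewrite mulnCA natrM padic_absM // -[leRHS]mulr1 ler_pM ?padic_abs_ge0 //.
exact: padic_abs_nat.
Qed.

(** The terms start at j = n, and the factor |x|_p^(-2) gained from one j to the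
    next outweighs the linear growth of the bound on the coefficients. *)
Lemma padic_abs_rem_sum J n : padic_abs p (rem_sum x J n) <=
  n.*2.+1%:R * padic_abs p n`!%:R ^+ 2 * (padic_abs p x)^-1 ^+ n.*2.
Proof.
set X := padic_abs p x; set f := padic_abs p n`!%:R.
have f0 : 0 <= f by rewrite padic_abs_ge0.
have X0 : 0 <= X^-1 by rewrite invr_ge0 padic_abs_ge0.
have X2 : X^-1 <= 2^-1 by rewrite lef_pV2 ?posrE // (lt_le_trans _ x_large).
have e0 : 0 <= n.*2.+1%:R * f ^+ 2 * X^-1 ^+ n.*2 by rewrite !mulr_ge0 ?exprn_ge0.
apply: (padic_abs_sum p_pr (u := fun j => rem_coef n j / rpoch x j.+1)) => // j _.
case: (ltnP j n) => [lt|le].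
  rewrite /rem_coef bin_small; last by rewrite ltnS -addnn ltn_add2l.
  by rewrite mulr0 mul0r padic_abs0.
rewrite padic_absM // padic_absV // padic_abs_rpoch // -/X -exprVn.
apply: (@le_trans _ _ (j.*2.+1%:R * f ^+ 2 * X^-1 ^+ j.+1.*2)).
  rewrite ler_wpM2r ?exprn_ge0 //; apply: le_trans (padic_abs_rem_coef _ _) _.
  by rewrite ler_wpM2l // lerXn2r ?nnegrE ?padic_abs_ge0 ?padic_abs_fact_le.
rewrite -(subnKC le); move: (j - n)%N => d.
have -> : ((n + d).+1.*2 = n.*2 + d.+1.*2)%N by lia.
rewrite exprD [X^-1 ^+ _ * _]mulrC mulrA ler_wpM2r ?exprn_ge0 // mulrAC ler_wpM2r ?exprn_ge0 //.
apply: (@le_trans _ _ ((n + d).*2.+1%:R * (2^-1) ^+ d.+1.*2)).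
  by rewrite ler_wpM2l // lerXn2r ?nnegrE.
rewrite half_expE ler_pdivrMr ?ltr0n ?expn_gt0 // -natrM ler_nat.
have : (d.+1 < 2 ^ d.+1)%N := ltn_expl _ (ltnSn 1).
rewrite -[d.+1.*2]addnn expnD; move: (2 ^ d.+1)%N => m.
move=> dm; have : (d + d + 1 <= m * m)%N by nia.
by rewrite -!addnn; move: (m * m)%N => k; nia.
Qed.

Lemma null_rem_coef n : padic_null_seq p (fun J => rem_coef n J / rpoch x J).
Proof.
apply: (@padic_null_of_le p _ 16) => J.
apply: (@le_trans _ _ (J.*2.+1%:R * 2^-1 ^+ J)); last first.
  apply: (@le_trans _ _ (2 * (J.+1%:R ^+ 2 * 2^-1 ^+ J))).
    rewrite mulrA ler_wpM2r ?exprn_ge0 // -natrX -natrM ler_nat expnS expn1; nia.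
  by rewrite (_ : 16 = 2 * 8 :> rat) -?[leRHS]mulrA ?ler_pM2l ?sqr_half_exp //; ring.
rewrite padic_absM // padic_absV //; apply: ler_pM; rewrite ?invr_ge0 ?padic_abs_ge0 //.
  apply: le_trans (padic_abs_rem_coef _ _) _.
  by rewrite -[leRHS]mulr1 ler_wpM2l // exprn_ile1 ?padic_abs_ge0 ?padic_abs_nat.
apply: le_trans (padic_abs_rpochV p_pr x_large _) _.
by rewrite ler_wiXn2l ?invr_ge0 ?invf_le1 // -addnn; lia.
Qed.

(** The defect satisfies the recurrence up to a boundary term tending to 0
    p-adically, and its first two values tend to 0. *)
Lemma null_rem_defect n : padic_null_seq p (fun J => rem_defect x J n).
Proof.
suff [] : padic_null_seq p (fun J => rem_defect x J n) /\
          padic_null_seq p (fun J => rem_defect x J n.+1) by [].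
elim: n => [|n [IH0 IH1]].
  split; first by move=> e e0; exists 0%N => J _; rewrite rem_defect0 padic_abs0.
  have := padic_nullM p_pr 2 (null_rem_coef 0); congr padic_null_seq.
  by apply: boolp.funext => J; rewrite rem_defect1 // mulrA.
split=> //.
have n2 : n%:R + 2 != 0 :> rat by rewrite -natrD pnatr_eq0 addnS.
pose c0 : rat := 2 * (2 * n%:R + 3) / (n%:R + 2) ^+ 3.
pose c1 := (2 * n%:R + 3) * ((n%:R + 1) ^+ 2 + n%:R + 2 - 2 * (x * (1 - x))) / (n%:R + 2) ^+ 3.
pose c2 : rat := - ((n%:R + 1) ^+ 3 / (n%:R + 2) ^+ 3).
have := padic_nullD p_pr (padic_nullM p_pr c0 (null_rem_coef n.+1))
  (padic_nullD p_pr (padic_nullM p_pr c1 IH1) (padic_nullM p_pr c2 IH0)).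
congr padic_null_seq; apply: boolp.funext => J.
have n20 : (n%:R + 2) ^+ 3 != 0 :> rat by rewrite expf_neq0.
apply: (mulfI n20); have := rem_defect_rec x_nint J n; rewrite /apery_op /c0 /c1 /c2 => /eqP.
rewrite addrAC subr_eq => /eqP E.
have -> : (n%:R + 2) ^+ 3 * rem_defect x J n.+2 =
  2 * (2 * n%:R + 3) * rem_coef n.+1 J / rpoch x J +
  (2 * n%:R + 3) * ((n%:R + 1) ^+ 2 + n%:R + 2 - 2 * (x * (1 - x))) * rem_defect x J n.+1 -
  (n%:R + 1) ^+ 3 * rem_defect x J n by rewrite -E addrK.
have := rpoch_neq0 J x_nint; move: (rpoch x J) => w w0.
by field; rewrite n2 w0.
Qed.

(** Replacing T by a partial sum of large index turns the residual into the
    truncated remainder series, up to quantities smaller than any given bound. *)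
Lemma padic_abs_residual n y : padic_null_seq p (fun J => Tfact_sum x J.+1 - y) ->
  padic_abs p (residual x y n) <=
  n.*2.+1%:R * padic_abs p n`!%:R ^+ 2 * (padic_abs p x)^-1 ^+ n.*2.
Proof.
move=> hy; rewrite leNgt; apply/negP; set B := (_ * _ ^+ n.*2); set D := padic_abs p _ => BD.
have D0 : 0 < D.
  by apply: le_lt_trans BD; rewrite !mulr_ge0 ?exprn_ge0 ?invr_ge0 ?padic_abs_ge0.
have [N hN] := padic_nullM p_pr (apery_den x n) hy D0; have [K hK] := null_rem_defect n D0.
pose J := maxn N K; have := hN J (leq_maxl _ _).
have := hK J.+1 (leqW (leq_maxr _ _)).
have := le_lt_trans (padic_abs_rem_sum J.+1 n) BD => h1 h2 h3.
have : padic_abs p (- (apery_den x n * (Tfact_sum x J.+1 - y)) +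
    (rem_defect x J.+1 n + rem_sum x J.+1 n)) < D.
  by apply: (padic_absD_lt p_pr); [rewrite padic_absN | apply: (padic_absD_lt p_pr)].
have -> : - (apery_den x n * (Tfact_sum x J.+1 - y)) + (rem_defect x J.+1 n + rem_sum x J.+1 n) =
  residual x y n by rewrite /rem_defect /residual; ring.
by rewrite ltxx.
Qed.

End Remainder.

(** * Common denominators *)

Definition lcm_upto (n : nat) : nat := \big[lcmn/1%N]_(i < n) i.+1.

Lemma lcm_uptoS n : lcm_upto n.+1 = lcmn (lcm_upto n) n.+1.
Proof. by rewrite /lcm_upto big_ord_recr. Qed.

Lemma lcm_upto_gt0 n : (0 < lcm_upto n)%N.
Proof. by elim: n => [|n IH]; rewrite ?lcm_uptoS ?lcmn_gt0 ?IH // /lcm_upto big_ord0. Qed.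

Lemma dvdn_lcm_upto n i : (0 < i <= n)%N -> (i %| lcm_upto n)%N.
Proof.
elim: n => [|n IH]; first by case: i.
case/andP=> i0; rewrite lcm_uptoS leq_eqVlt => /orP[/eqP -> |lt]; first exact: dvdn_lcmr.
by rewrite (dvdn_trans (IH _)) ?dvdn_lcml // i0.
Qed.

Lemma leq_lcm_upto m n : (m <= n)%N -> (lcm_upto m <= lcm_upto n)%N.
Proof.
elim: n => [|n IH]; first by rewrite leqn0 => /eqP ->.
rewrite leq_eqVlt => /orP[/eqP -> //|lt]; apply: leq_trans (IH lt) _.
by rewrite dvdn_leq ?lcm_upto_gt0 // lcm_uptoS dvdn_lcml.
Qed.

Lemma lcm_upto_inv_int n i : (0 < i <= n)%N -> (lcm_upto n)%:R * i%:R^-1 \is a @Num.int rat.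
Proof.
move=> h; have /dvdnP[k ->] := dvdn_lcm_upto h; case/andP: h => i0 _.
by rewrite natrM mulfK ?pnatr_eq0 -?lt0n // natr_int.
Qed.

Lemma lcm_upto_beta_int n m l : (m + l < n)%N -> (lcm_upto n)%:R * beta_frac m l \is a Num.int.
Proof.
elim: l m => [|l IH] m h; first by rewrite beta_frac0 lcm_upto_inv_int //; lia.
by rewrite beta_fracS mulrBr rpredB // IH //; lia.
Qed.

(** For the primes of F, the full power occurring in n! has to be cleared from
    binomial coefficients evaluated at fractions of denominator F; the other
    primes do not occur in their denominators. *)
Definition prog_den (F n : nat) : nat := (F ^ n * n`!`_\pi(F))%N.

Lemma prog_den_dvd F l n : (l <= n)%N -> (prog_den F l %| prog_den F n)%N.
Proof.
move=> le; apply: dvdn_mul; first by rewrite dvdn_exp2l.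
by apply: partn_dvd; rewrite ?fact_gt0 // -(bin_fact le) mulnCA dvdn_mulr.
Qed.

Lemma prod_consecutive c l : (l`! %| \prod_(i < l) (c + i))%N.
Proof.
case: c => [|c].
  by case: l => [|l]; rewrite ?big_ord0 // big_ord_recl mul0n.
have E : (\prod_(i < l) (c.+1 + i) * c`! = (c + l)`!)%N.
  elim: l => [|l IH]; first by rewrite big_ord0 mul1n addn0.
  by rewrite big_ord_recr /= mulnAC IH addSn mulnC addnS factS.
have := bin_fact (leq_addl c l); rewrite addnK -E mulnA => /eqP.
by rewrite eqn_pmul2r ?fact_gt0 // => /eqP <-; apply: dvdn_mull.
Qed.

(** Modulo m, coprime to F, an arithmetic progression of difference F is F times a
    sequence of consecutive integers. *)
Lemma prod_progression (b : int) F m l : coprime F m -> (0 < m)%N -> (m %| l`!)%N ->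
  (m%:Z %| \prod_(i < l) (b + i%:Z * F%:Z))%Z.
Proof.
move=> cop m0 ml.
have /coprimezP[[u v] /= uv] : coprimez F%:Z m%:Z by [].
have mz : m%:Z != 0 by rewrite eqz_nat -lt0n.
(* a natural number congruent to b / F modulo m *)
pose c := absz (b * u %% m%:Z)%Z.
have cE : c%:Z = (b * u %% m%:Z)%Z by rewrite gez0_abs // modz_ge0.
have db : (m%:Z %| b - c%:Z * F%:Z)%Z.
  have -> : b - c%:Z * F%:Z = ((b * u %/ m%:Z)%Z * F%:Z + b * v) * m%:Z.
    rewrite cE; have := divz_eq (b * u) m%:Z; move: (_ %/ _)%Z (_ %% _)%Z => q w E.
    have -> : w = b * u - q * m%:Z by rewrite E addrAC subrr add0r.
    by rewrite -[X in X - _]mulr1 -uv; ring.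
  exact: dvdz_mull.
have diff : (m%:Z %| \prod_(i < l) (b + i%:Z * F%:Z) -
                    \prod_(i < l) (c%:Z * F%:Z + i%:Z * F%:Z))%Z.
  elim: (l) => [|k IH]; first by rewrite !big_ord0 subrr dvdz0.
  rewrite !big_ord_recr /=.
  set A := \prod_(i < k) (b + _) in IH *; set B := \prod_(i < k) (_ * _ + _) in IH *.
  have -> : A * (b + k%:Z * F%:Z) - B * (c%:Z * F%:Z + k%:Z * F%:Z) =
    (b + k%:Z * F%:Z) * (A - B) + B * (b - c%:Z * F%:Z) by ring.
  by apply: rpredD; apply: dvdz_mull.
have dc : (m%:Z %| \prod_(i < l) (c%:Z * F%:Z + i%:Z * F%:Z))%Z.
  have -> : \prod_(i < l) (c%:Z * F%:Z + i%:Z * F%:Z) =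
      F%:Z ^+ l * (\prod_(i < l) (c + i))%N%:Z.
    elim: (l) => [|k IH]; first by rewrite !big_ord0.
    by rewrite !big_ord_recr /= IH exprS PoszM PoszD; ring.
  by apply: dvdz_mull; apply: dvdn_trans ml (prod_consecutive c l).
by rewrite -[X in (_ %| X)%Z](subrK (\prod_(i < l) (c%:Z * F%:Z + i%:Z * F%:Z))) rpredD.
Qed.

Lemma prog_den_int (b : int) F l n : (0 < F)%N -> (l <= n)%N ->
  (prog_den F n)%:R * (\prod_(i < l) (b%:~R / F%:R + i%:R) / l`!%:R) \is a @Num.int rat.
Proof.
move=> F0 le; have /dvdnP[k ->] := prog_den_dvd F le.
rewrite natrM -mulrA rpredM ?natr_int // /prog_den natrM natrX.
have Fn0 : F%:R != 0 :> rat by rewrite pnatr_eq0 -lt0n.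
have -> : F%:R ^+ l * (l`!`_\pi(F))%:R * (\prod_(i < l) (b%:~R / F%:R + i%:R) / l`!%:R)
  = (F%:R ^+ l * \prod_(i < l) (b%:~R / F%:R + i%:R)) * ((l`!`_\pi(F))%:R / l`!%:R) :> rat.
  by ring.
have -> : F%:R ^+ l * \prod_(i < l) (b%:~R / F%:R + i%:R) =
    (\prod_(i < l) (b + i%:Z * F%:Z))%:~R :> rat.
  elim: l {le} => [|j IH]; first by rewrite !big_ord0 mulr1.
  rewrite !big_ord_recr /= intrM -IH exprS rmorphD rmorphM /=.
  by field.
set m := (l`!`_(\pi(F)^'))%N.
have m0 : (0 < m)%N by rewrite part_gt0.
have pm : (l`!`_\pi(F) * m)%N = l`! by rewrite partnC ?fact_gt0.
have -> : (l`!`_\pi(F))%:R / l`!%:R = m%:R^-1 :> rat.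
  rewrite -[in X in _ / X]pm natrM invfM mulrA mulfV ?mul1r //.
  by rewrite pnatr_eq0 -lt0n part_gt0.
have cop : coprime F m by rewrite (pnat_coprime (pi := \pi(F))) ?pnat_pi ?part_pnat.
have ml : (m %| l`!)%N by rewrite -pm dvdn_mull.
have /dvdzP[q ->] := prod_progression b cop m0 ml.
by rewrite intrM mulfK ?pnatr_eq0 -?lt0n // intr_int.
Qed.

Section Denominators.
Variables (a : int) (F : nat).
Hypothesis F_gt0 : (0 < F)%N.
Let x : rat := a%:~R / F%:R.
Hypothesis x_nint : forall m : int, x + m%:~R != 0.

(** One factor lcm(1..n) clears 1/(j+1), the two others the square of a fraction
    B(j+1, k-j). *)
Definition common_den (n : nat) : nat := (lcm_upto n ^ 3 * prog_den F n ^ 2)%N.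

Lemma legendre_coef_int n k : legendre_coef n k \is a Num.int. Proof. exact: natr_int. Qed.

Lemma prog_den_pair_int n j l : (l <= n)%N ->
  (prog_den F n)%:R ^+ 2 * ((\prod_(i < l) (x + j%:R + i%:R) / l`!%:R) *
    (\prod_(i < l) (1 - x + j%:R + i%:R) / l`!%:R)) \is a Num.int.
Proof.
move=> le; have Fn0 : F%:R != 0 :> rat by rewrite pnatr_eq0 -lt0n.
rewrite expr2 mulrACA rpredM //.
  have -> : x + j%:R = (a + j%:Z * F%:Z)%:~R / F%:R :> rat.
    by rewrite rmorphD rmorphM /= /x; field.
  exact: prog_den_int.
have -> : 1 - x + j%:R = (F%:Z - a + j%:Z * F%:Z)%:~R / F%:R :> rat.
  by rewrite rmorphD rmorphB rmorphM /= /x; field.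
exact: prog_den_int.
Qed.

Lemma rpoch_split (y : rat) k : rpoch y k = \prod_(i < k) (y + i%:R) * \prod_(i < k) (1 - y + i%:R).
Proof. by rewrite /rpoch big_split. Qed.

Lemma apery_den_int n : (common_den n)%:R * apery_den x n \is a Num.int.
Proof.
rewrite /common_den natrM -mulrA rpredM ?natr_int //.
rewrite /apery_den mulr_sumr rpred_sum // => k _.
have := @prog_den_pair_int n 0 k; rewrite -ltnS ltn_ord => /(_ isT).
rewrite !addr0 /den_term rpoch_split natrX natrX => h.
have -> : forall s t u v w f : rat,
  u * (s * t * (v * w / f ^+ 2)) = s * t * (u * (v / f * (w / f))).
  by move=> *; rewrite expr2 invfM; ring.
by rewrite rpredM // rpredM ?legendre_coef_int // rpredX // rpredN1.
Qed.

(** In the term of indices j < k the product W_(j+1) divides W_k, and the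
    quotient W_k / W_(j+1) consists of two products of l = k-j-1 factors; what
    remains of j!^2 / k!^2 beyond 1 / l!^2 is the square of B(j+1, l+1). *)
Lemma apery_num_int n : (common_den n)%:R * apery_num x n \is a Num.int.
Proof.
rewrite /apery_num mulr_sumr rpred_sum // => k _.
rewrite /Tfact_sum !mulr_sumr rpred_sum // => j _.
have kn : (k <= n)%N by rewrite -ltnS.
have jk := ltn_ord j; move: (nat_of_ord k) (nat_of_ord j) kn jk => {}k {}j kn jk.
pose l := (k - j.+1)%N.
have kE : k = (j.+1 + l)%N by rewrite subnKC.
have [jn jln ln] : [/\ (0 < j.+1 <= n)%N, (j + l < n)%N & (l <= n)%N].
  by move: kE; clearbody l; split; lia.
have split_wp : rpoch x k = rpoch x j.+1 * (\prod_(i < l) (x + j.+1%:R + i%:R) *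
    \prod_(i < l) (1 - x + j.+1%:R + i%:R)).
  rewrite kE; elim: (l) => [|d IH]; first by rewrite addn0 !big_ord0 !mulr1.
  by rewrite addnS rpochS IH !big_ord_recr /= natrD; ring.
have hA := lcm_upto_inv_int jn.
have hB := lcm_upto_beta_int jln.
have hC := prog_den_pair_int j.+1 ln.
have w0 := rpoch_neq0 j.+1 x_nint.
have -> : (common_den n)%:R * (den_term x n k * - ((j`! ^ 2)%N%:R / j.+1%:R / rpoch x j.+1)) =
  - ((-1) ^+ k * legendre_coef n k * ((lcm_upto n)%:R * j.+1%:R^-1) *
   ((lcm_upto n)%:R * beta_frac j l) ^+ 2 *
   ((prog_den F n)%:R ^+ 2 * ((\prod_(i < l) (x + j.+1%:R + i%:R) / l`!%:R) *
    (\prod_(i < l) (1 - x + j.+1%:R + i%:R) / l`!%:R)))).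
  rewrite /den_term split_wp /common_den !(natrM, natrX) /beta_frac.
  have -> : (j + l).+1 = k by rewrite kE addSn.
  have fk := fact_neq0 k; have fj := fact_neq0 j; have fl := fact_neq0 l.
  have j1 : j.+1%:R != 0 :> rat by rewrite pnatr_eq0.
  move: (\prod_(i < l) _) (\prod_(i < l) _) (rpoch x j.+1) w0 => A B w w0.
  move: (k`!%:R : rat) (j`!%:R : rat) (l`!%:R : rat) (j.+1%:R : rat) fk fj fl j1.
  by move=> f g h m f0 g0 h0 m0; field; rewrite f0 h0 m0 w0.
rewrite rpredN; apply: rpredM hC; apply: rpredM; last exact: rpredX.
by apply: rpredM hA; rewrite rpredM ?legendre_coef_int ?rpredX ?rpredN1.
Qed.

End Denominators.

(** * Chebyshev's bound for lcm(1, ..., n), and growth of solutions of the recurrence *)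

Section LcmNat.
Local Open Scope nat_scope.

Lemma lcm_upto_pfactor q e m : prime q -> (0 < e)%N -> (q ^ e %| lcm_upto m)%N -> (q ^ e <= m)%N.
Proof.
move=> q_pr e0; elim: m => [|m IH].
  rewrite /lcm_upto big_ord0 dvdn1 => /eqP E.
  by have := ltn_expl e (prime_gt1 q_pr); rewrite E; lia.
rewrite lcm_uptoS pfactor_dvdn ?lcmn_gt0 ?lcm_upto_gt0 // logn_lcm ?lcm_upto_gt0 //.
rewrite leq_max -!pfactor_dvdn ?lcm_upto_gt0 // => /orP[/IH/leqW //|].
exact: dvdn_leq.
Qed.

Lemma logn_lcm_upto q m n : prime q -> (m <= n)%N ->
  (logn q (lcm_upto m) <= \sum_(1 <= i < n.+1) (q ^ i <= m))%N.
Proof.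
move=> q_pr mn; set e := logn q _.
have [->//|e0] := posnP e.
have qm : (q ^ e <= m)%N by apply: lcm_upto_pfactor => //; apply: pfactor_dvdnn.
have en : (e <= n)%N by apply: leq_trans (leq_trans qm mn); apply/ltnW/ltn_expl/prime_gt1.
rewrite (big_cat_nat (n := e.+1)) //= -[X in (X <= _)%N]addn0 leq_add //.
apply: (@leq_trans (\sum_(1 <= i < e.+1) 1)).
  by rewrite sum_nat_const_nat subn1 muln1.
rewrite !big_nat; apply: leq_sum => i /andP[_ ie].
by rewrite (leq_trans _ qm) // leq_exp2l ?prime_gt1.
Qed.

(** Both sides count the pairs (k, i) with i >= 1 and k q^i <= n for each prime q,
    by Legendre's formula on the right. *)
Lemma prod_lcm_upto_dvd n : (\prod_(1 <= k < n.+1) lcm_upto (n %/ k) %| n`!)%N.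
Proof.
apply/dvdn_partP; first by rewrite prodn_gt0 // => k; apply: lcm_upto_gt0.
move=> q; rewrite mem_primes => /andP[q_pr _].
rewrite p_part pfactor_dvdn ?fact_gt0 // logn_fact //.
have -> : logn q (\prod_(1 <= k < n.+1) lcm_upto (n %/ k)) =
    \sum_(1 <= k < n.+1) logn q (lcm_upto (n %/ k)).
  elim: (index_iota _ _) => [|k s IH]; first by rewrite !big_nil logn1.
  rewrite !big_cons lognM ?IH ?lcm_upto_gt0 // prodn_gt0 // => i; exact: lcm_upto_gt0.
apply: (@leq_trans (\sum_(1 <= k < n.+1) \sum_(1 <= i < n.+1) (q ^ i <= n %/ k))).
  by apply: leq_sum => k _; apply: logn_lcm_upto; rewrite // leq_div.
rewrite exchange_big /= leq_sum // => i _.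
have q0 : (0 < q ^ i)%N by rewrite expn_gt0 prime_gt0.
rewrite big_nat_cond (eq_bigr (fun k => (k <= n %/ q ^ i)%N : nat)); last first.
  by move=> k /andP[/andP[k0 _] _]; rewrite !leq_divRL // mulnC.
rewrite -big_nat_cond; move: (n %/ q ^ i)%N => m.
have -> : (\sum_(1 <= k < n.+1) (k <= m) = minn n m)%N; last exact: geq_minr.
elim: n => [|d IH]; first by rewrite big_nil min0n.
by rewrite big_nat_recr //= IH; case: leqP; lia.
Qed.

End LcmNat.

Section Chebyshev.
Variable R : realType.

Lemma ln_nat_ge0 (n : nat) : 0 <= ln n%:R :> R.
Proof.
case: n => [|n]; first by rewrite ln0.
by rewrite ln_ge0 // ler1n.
Qed.

Lemma ler_ln_nat (m n : nat) : (0 < m <= n)%N -> ln m%:R <= ln n%:R :> R.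
Proof.
case/andP=> m0 mn; have n0 : (0 < n)%N by apply: leq_trans mn.
by rewrite ler_ln ?posrE ?ltr0n // ler_nat.
Qed.

Lemma lnM_nat (m n : nat) : (0 < m)%N -> (0 < n)%N ->
  ln (m * n)%N%:R = ln m%:R + ln n%:R :> R.
Proof. by move=> m0 n0; rewrite natrM lnM ?posrE ?ltr0n. Qed.

Lemma ln_prod_nat (f : nat -> nat) (s : seq nat) : {in s, forall k, (0 < f k)%N} ->
  ln (\prod_(k <- s) f k)%N%:R = \sum_(k <- s) ln (f k)%:R :> R.
Proof.
move=> f0; rewrite !big_seq.
suff [] : (0 < \prod_(k <- s | k \in s) f k)%N /\
  ln (\prod_(k <- s | k \in s) f k)%N%:R = \sum_(k <- s | k \in s) ln (f k)%:R :> R by [].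
apply: (big_rec2 (fun (P : nat) (S : R) => (0 < P)%N /\ ln P%:R = S)).
  by rewrite ln1.
by move=> k P S /f0 k0 [P0 <-]; rewrite muln_gt0 k0 P0 lnM_nat.
Qed.

(** Summation of ln (1 + 1/k) <= 1/k. *)
Lemma ln_harmonic n : ln n.+1%:R <= \sum_(1 <= k < n.+1) k%:R^-1 :> R.
Proof.
elim: n => [|n IH]; first by rewrite big_nil ln1.
rewrite big_nat_recr //= -[n.+2%:R](mulfVK (_ : n.+1%:R != 0 :> R)) ?pnatr_eq0 //.
rewrite lnM ?posrE ?divr_gt0 ?ltr0n // addrC lerD //.
have -> : n.+2%:R / n.+1%:R = 1 + n.+1%:R^-1 :> R.
  by rewrite -natr1 mulrDl mulfV ?pnatr_eq0 // mul1r.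
by rewrite le_ln1Dx // (lt_le_trans (_ : _ < 0)) ?invr_ge0 ?ltrN10.
Qed.

(** From ln t < t at t = e (n+1). *)
Lemma ln_sublinear_nat (e : R) : 0 < e ->
  exists C : R, forall n : nat, ln n.+1%:R <= e * n%:R + C.
Proof.
move=> e0; exists (e - ln e) => n.
have n0 : 0 < n.+1%:R :> R by rewrite ltr0n.
have := ltW (ln_sublinear (mulr_gt0 e0 n0)).
by rewrite lnM ?posrE // -[n.+1%:R]natr1; lra.
Qed.

Lemma ln_unbounded (B : R) : exists m : nat, B < ln m.+1%:R.
Proof.
exists (Num.truncn (expR B)); rewrite -[B in B < _]expRK.
by rewrite ltr_ln ?posrE ?expR_gt0 ?ltr0n // truncnS_gt.
Qed.

Lemma ln_fact_le n : (0 < n)%N -> ln n`!%:R <= n%:R * ln n%:R :> R.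
Proof.
move=> n0; rewrite mulr_natl -lnXn ?ltr0n // -natrX ler_ln_nat // fact_gt0 /=.
elim: n {n0} => // n IH; rewrite factS expnS leq_mul //.
by apply: leq_trans IH _; case: n => // n; rewrite leq_exp2r.
Qed.

(** Otherwise lcm(1..m) exceeds exp ((1+e) m) for all m >= N, for some N, and the
    factors with k <= n/N alone make the product of the lcm(1..n/k) about
    exp ((1+e) n ln (n/N)), more than n!, which is at most exp (n ln n). *)
Lemma lcm_upto_small (e : R) (N0 : nat) : 0 < e ->
  exists2 n, (N0 <= n)%N & ln (lcm_upto n)%:R <= (1 + e) * n%:R.
Proof.
move=> e0; apply: contrapT => H.
pose N := N0.+1.
have big n : (N <= n)%N -> (1 + e) * n%:R <= ln (lcm_upto n)%:R.
  move=> Nn; rewrite leNgt; apply/negP => h; apply: H.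
  by exists n; [exact: ltnW | exact: ltW].
have [m hm] := ln_unbounded ((ln N%:R + 1 + e) / e).
(* a multiple of N, so that n/k >= N exactly when k <= m+1 *)
pose n := (N * m.+1)%N.
have n0 : (0 < n)%N by rewrite muln_gt0.
have nR : 0 < n%:R :> R by rewrite ltr0n.
have le1 : \sum_(1 <= k < n.+1) ln (lcm_upto (n %/ k))%:R <= n%:R * ln n%:R :> R.
  apply: le_trans (ln_fact_le n0).
  rewrite -(@ln_prod_nat (fun k => lcm_upto (n %/ k))) => [|k _]; last exact: lcm_upto_gt0.
  apply: ler_ln_nat; rewrite [X in _ && X]dvdn_leq ?fact_gt0 ?prod_lcm_upto_dvd //.
  by rewrite andbT; apply: prodn_gt0 => k; apply: lcm_upto_gt0.
have mn : (m.+2 <= n.+1)%N by rewrite ltnS leq_pmull.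
have le2 : \sum_(1 <= k < m.+2) (1 + e) * (n%:R * k%:R^-1 - 1) <=
    \sum_(1 <= k < n.+1) ln (lcm_upto (n %/ k))%:R :> R.
  rewrite [leRHS](big_cat_nat (n := m.+2)) //= -[leLHS]addr0 lerD //; last first.
    by apply: sumr_ge0 => k _; apply: ln_nat_ge0.
  rewrite !big_nat; apply: ler_sum => k /andP[k0 km].
  apply: le_trans (big _ _); last by rewrite leq_divRL // leq_mul2l -ltnS km orbT.
  rewrite ler_pM2l ?addr_gt0 // lerBlDr natr1 ler_pdivrMr ?ltr0n //.
  by rewrite -natrM ler_nat ltnW // ltn_ceil.
have := le_trans le2 le1; rewrite -mulr_sumr sumrB -mulr_sumr.
rewrite sumr_const_nat subn1 /= => le3.
have le4 := ln_harmonic m.+1.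
have le5 : ln m.+1%:R <= ln m.+2%:R :> R by apply: ler_ln_nat; rewrite /= leqnSn.
have lnn : ln n%:R = ln N%:R + ln m.+1%:R :> R by rewrite lnM_nat.
have mnR : m.+1%:R <= n%:R :> R by rewrite ler_nat.
have e1 : 0 < 1 + e by rewrite addr_gt0.
have : (1 + e) * (n%:R * ln m.+1%:R - n%:R) <= n%:R * (ln N%:R + ln m.+1%:R).
  rewrite -lnn; apply: le_trans le3; rewrite ler_pM2l // lerB //.
  by rewrite ler_pM2l // (le_trans le5).
rewrite -[X in _ * (_ - X)]mulr1 -mulrBr mulrCA ler_pM2l //.
rewrite ltr_pdivrMr // in hm; lra.
Qed.

(** In terms of D_n = (n+1)^3 (u_(n+1) - u_n) the recurrence reads
    D_(n+1) = D_n - 2 Y (2n+3) u_(n+1), so D_n is O(n^2) times the largest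
    earlier value of u, and passing from n to n+1 multiplies that largest
    value by 1 + O(1/n). *)
Lemma apery_growth (Y : R) (u : nat -> R) (e : R) : 0 < e ->
  (forall n : nat, (n%:R + 2) ^+ 3 * u n.+2
    - (2 * n%:R + 3) * ((n%:R + 1) ^+ 2 + n%:R + 2 - 2 * Y) * u n.+1
    + (n%:R + 1) ^+ 3 * u n = 0) ->
  exists2 C : R, 0 < C & forall n, `|u n| <= C * (1 + e) ^+ n.
Proof.
move=> e0 rec; pose A := 2 * `|Y|; have A0 : 0 <= A by rewrite mulr_ge0.
pose D (n : nat) := (n%:R + 1) ^+ 3 * (u n.+1 - u n).
have DS n : D n.+1 = D n - 2 * Y * (2 * n%:R + 3) * u n.+1.
  apply/eqP; rewrite -subr_eq0 -(rec n) /D -natr1; apply/eqP; ring.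
have boundD M n : (0 < n)%N -> (forall k, (k <= n)%N -> `|u k| <= M) ->
    `|D n| <= (2 + A * (n%:R + 1) ^+ 2) * M.
  move=> n0 hM; have M0 : 0 <= M by apply: le_trans (hM 0%N _).
  have : (n <= n)%N by []; elim: {1 3 4}n => [|j IH] jn.
    rewrite /D add0r expr1n mul1r expr1n mulr1 mulrDl mulrDl mul1r.
    rewrite (le_trans (ler_normB _ _)) // (le_trans (lerD (hM 1%N n0) (hM 0%N _))) //.
    by rewrite lerDl mulr_ge0.
  rewrite DS (le_trans (ler_normB _ _)) //.
  have := IH (ltnW jn); have := hM _ jn; rewrite !normrM.
  have -> : `|2 * j%:R + 3| = 2 * j%:R + 3 :> R by rewrite ger0_norm ?addr_ge0 ?mulr_ge0.
  have -> : `|2| = 2 :> R by rewrite ger0_norm.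
  have j0 : 0 <= j%:R :> R by [].
  rewrite -/A -natr1 => h1 h2.
  have h3 : A * (2 * j%:R + 3) * `|u j.+1| <= A * (2 * j%:R + 3) * M.
    by rewrite ler_wpM2l // mulr_ge0 ?addr_ge0 ?mulr_ge0.
  apply: le_trans (lerD h2 h3) _; rewrite le_eqVlt; apply/orP; left; apply/eqP; ring.
(* from index N on, one step increases the bound by a factor at most 1 + e *)
pose N := (Num.truncn ((A + 2) / e)).+1.
pose C : R := 1 + \sum_(k < N.+1) `|u k|.
have C0 : 0 < C by rewrite ltr_pwDl // sumr_ge0.
have small k : (k <= N)%N -> `|u k| <= C.
  move=> kN; rewrite /C (bigD1 (Ordinal (kN : (k < N.+1)%N))) //= addrCA lerDl.
  by rewrite addr_ge0 // sumr_ge0.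
have e1 : 1 <= 1 + e by rewrite lerDl ltW.
suff main d k : (k <= N + d)%N -> `|u k| <= C * (1 + e) ^+ (N + d).
  exists (C * (1 + e) ^+ N) => [|n]; first by rewrite mulr_gt0 // exprn_gt0 // (lt_le_trans _ e1).
  by rewrite -mulrA -exprD; apply: main; rewrite leq_addl.
elim: d k => [|d IH] k.
  rewrite addn0 => /small h; apply: le_trans h _.
  by apply: ler_peMr; [exact: ltW | exact: exprn_ege1].
rewrite addnS; set n := (N + d)%N in IH *; set M := C * _ ^+ n in IH.
have M0 : 0 <= M by rewrite mulr_ge0 ?ltW // exprn_gt0 // (lt_le_trans _ e1).
have MS : C * (1 + e) ^+ n.+1 = (1 + e) * M by rewrite exprS mulrCA.
rewrite MS leq_eqVlt => /orP[/eqP -> |kn]; last first.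
  by apply: le_trans (IH k kn) _; rewrite ler_peMl.
have hD := boundD M n isT IH.
have n1 : 0 < n%:R + 1 :> R by rewrite ltr_wpDl.
have n13 : 0 < (n%:R + 1) ^+ 3 :> R by rewrite exprn_gt0.
have step : `|u n.+1 - u n| <= e * M.
  rewrite -(ler_pM2l n13) -[X in X * `|_|](gtr0_norm n13) -normrM.
  apply: le_trans hD _; rewrite [leRHS]mulrA ler_wpM2r //.
  have hn : A + 2 <= e * (n%:R + 1).
    rewrite mulrC -ler_pdivrMr // natr1; apply/ltW/(lt_le_trans (truncnS_gt _)).
    by rewrite ler_nat ltnS (leq_trans _ (leq_addr _ _)).
  have : (A + 2) * (n%:R + 1) ^+ 2 <= e * (n%:R + 1) * (n%:R + 1) ^+ 2.
    by rewrite ler_wpM2r // exprn_ge0 // ltW.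
  have : 1 <= (n%:R + 1) ^+ 2 :> R by rewrite exprn_ege1 // lerDr.
  by rewrite [_ ^+ 3]exprS; nra.
rewrite -[u n.+1](subrK (u n)) (le_trans (ler_normD _ _)) //.
by rewrite mulrDl mul1r addrC lerD // IH.
Qed.

End Chebyshev.

(** * Comparison of the sizes *)

(** One step replaces the floor of n/p^K by p times the floor of n/p^(K+1) plus a
    remainder between 0 and p-1; this gives both bounds on the valuation of n!. *)
Lemma legendre_partial p n K : prime p ->
  ((p.-1 * \sum_(1 <= k < K.+1) n %/ p ^ k + n %/ p ^ K <= n) &&
   (n <= p.-1 * \sum_(1 <= k < K.+1) n %/ p ^ k + n %/ p ^ K + p.-1 * K))%N.
Proof.
move=> p_pr; have p1 := prime_gt1 p_pr.
elim: K => [|K /andP[IH1 IH2]]; first by rewrite big_nil divn1; lia.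
rewrite big_nat_recr //= expnS mulnC -!(mulnC p.-1) [(p * _)%N]mulnC divnMA.
have := divn_eq (n %/ p ^ K) p; have := ltn_pmod (n %/ p ^ K) (ltnW p1).
move: (_ %/ p)%N (_ %% p)%N => b c cp E.
move: IH1 IH2; rewrite {}E; move: (\sum_(1 <= k < K.+1) _)%N => s.
by case: p p1 cp {p_pr} => //= p _ cp; move=> *; apply/andP; split; nia.
Qed.

Lemma logn_fact_upper q n : prime q -> (q.-1 * logn q n`! <= n)%N.
Proof.
move=> q_pr; rewrite logn_fact //.
by have /andP[h _] := legendre_partial n n q_pr; apply: leq_trans h; apply: leq_addr.
Qed.

Lemma logn_fact_lower p n : prime p -> (0 < n)%N ->
  (n <= p.-1 * (logn p n`! + trunc_log p n + 1))%N.
Proof.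
move=> p_pr n0; set K := trunc_log p n.
have p1 := prime_gt1 p_pr.
have /andP[pK nK] := trunc_log_bounds p1 n0; rewrite -/K in pK nK.
have /andP[_ h] := legendre_partial n K p_pr.
have hK : (n %/ p ^ K <= p.-1)%N.
  by rewrite -ltnS prednK ?(ltnW p1) // ltn_divLR ?expn_gt0 ?(ltnW p1) // -expnS.
have Kn : (K <= n)%N by apply: leq_trans pK; apply/ltnW/ltn_expl.
have hs : (\sum_(1 <= k < K.+1) n %/ p ^ k <= logn p n`!)%N.
  by rewrite logn_fact // [leqRHS](big_cat_nat (n := K.+1)) //= leq_addr.
apply: leq_trans h _; rewrite !mulnDr muln1.
have := leq_mul (leqnn p.-1) hs; lia.
Qed.

Lemma partn_primes F m : (0 < m)%N -> (0 < F)%N ->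
  (m`_\pi(F) = \prod_(q <- primes F) q ^ logn q m)%N.
Proof.
move=> m0 F0; rewrite (widen_partn _ (leq_maxl m F)) -big_filter.
apply: perm_big; apply: uniq_perm; rewrite ?filter_uniq ?iota_uniq ?primes_uniq //.
move=> q; rewrite mem_filter mem_index_iota /=.
apply/andP/idP => [[]//|qF]; split=> //.
move: qF; rewrite mem_primes => /and3P[_ _ /(dvdn_leq F0) qF].
by rewrite ltnS leq_max qF orbT.
Qed.

Section ProductFormula.
Variables (p : nat) (p_pr : prime p).

(** The p-part of a nonzero integer is at most its absolute value. *)
Lemma product_formula (m : int) : m != 0 -> 1 <= `|m%:~R| * padic_abs p m%:~R.
Proof.
move=> m0; have am0 : (0 < absz m)%N by rewrite absz_gt0.
have -> : padic_abs p m%:~R = padic_abs p (absz m)%:R.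
  by case: (m) => n //; rewrite NegzE rmorphN padic_absN abszN.
have -> : `|m%:~R| = (absz m)%:R :> rat by rewrite -intr_norm -abszE.
rewrite padic_abs_natE // ler_pdivlMr ?ltr0n ?expn_gt0 ?prime_gt0 // mul1r ler_nat.
by rewrite dvdn_leq // pfactor_dvdnn.
Qed.

Lemma padic_abs_unit (a : int) : ~~ (p%:Z %| a)%Z -> padic_abs p a%:~R = 1.
Proof.
move=> pa; have a0 : a != 0 by apply: contraNneq pa => ->; apply: dvdz0.
have := @padic_val_frac p a 1 a0 (oner_neq0 _); rewrite divr1 => E.
rewrite /padic_abs intr_eq0 (negPf a0) E logn1 subr0.
by rewrite dvdzE /= in pa; rewrite logn_coprime // prime_coprime.
Qed.

End ProductFormula.

Section Irrationality.
Variables (p : nat) (p_pr : prime p) (a : int) (F : nat).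
Hypothesis a_ndvd : ~~ (p%:Z %| a)%Z.
Hypotheses (F_gt0 : (0 < F)%N) (pF : (p %| F)%N).
Let s := logn p F.
Let x : rat := a%:~R / F%:R.

Lemma logn_F_gt0 : (0 < s)%N.
Proof. by rewrite logn_gt0 mem_primes p_pr F_gt0. Qed.

Lemma padic_abs_arg : padic_abs p x = (p ^ s)%N%:R.
Proof.
by rewrite /x padic_absM // padic_absV // padic_abs_unit // mul1r padic_abs_natE // invrK.
Qed.

Lemma arg_large : 2 <= padic_abs p x.
Proof.
rewrite padic_abs_arg ler_nat (leq_trans (prime_gt1 p_pr)) //.
by rewrite -[X in (X <= _)%N]expn1 leq_exp2l ?prime_gt1 // logn_F_gt0.
Qed.

(** Both F^n and the part of n! at the primes of F contribute their whole power
    of p, as p divides F. *)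
Lemma padic_abs_common_den n :
  padic_abs p (common_den F n)%:R <= (p ^ (2 * (logn p n`! + n * s)))%N%:R^-1.
Proof.
rewrite padic_abs_natE //; last first.
  by rewrite muln_gt0 !expn_gt0 lcm_upto_gt0 muln_gt0 expn_gt0 F_gt0 part_gt0.
rewrite lef_pV2 ?posrE ?ltr0n ?expn_gt0 ?prime_gt0 // ler_nat leq_exp2l ?prime_gt1 //.
have pin : p \in \pi(F) by rewrite mem_primes p_pr F_gt0.
have mu0 : (0 < prog_den F n)%N by rewrite muln_gt0 expn_gt0 F_gt0 part_gt0.
rewrite /common_den lognM ?expn_gt0 ?lcm_upto_gt0 ?mu0 // [logn p (prog_den F n ^ 2)]lognX.
apply: leq_trans (leq_addl _ _); rewrite leq_mul2l /= /prog_den.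
rewrite lognM ?expn_gt0 ?F_gt0 ?part_gt0 // lognX addnC leq_add2l.
by rewrite -pfactor_dvdn ?part_gt0 // partn_primes ?fact_gt0 // (big_rem p) //= dvdn_mulr.
Qed.

Section Rational.
Variable y : rat.
Hypothesis Ty : Tp p_pr a F = ratr y.

Local Notation rho := (residual x y).

Lemma residual_small n : padic_abs p (rho n) <=
  n.*2.+1%:R * (p ^ (2 * (logn p n`! + n * s)))%N%:R^-1.
Proof.
have := padic_abs_residual p_pr arg_large n (Tfact_cvg_rational arg_large Ty).
move=> h; apply: le_trans h _; rewrite -mulrA ler_wpM2l //.
rewrite padic_abs_arg padic_abs_natE ?fact_gt0 // !exprVn -invfM -!natrX -natrM.
rewrite -!expnM -expnD le_eqVlt; apply/orP; left; apply/eqP.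
by congr (_ ^ _)%N%:R^-1; rewrite -mul2n; lia.
Qed.

(** The residual times the common denominator and the denominator of y is a
    nonzero integer, to which the product formula applies. *)
Lemma residual_lower n : rho n != 0 ->
  (p ^ (4 * (logn p n`! + n * s)))%N%:R <=
  (common_den F n)%:R * (denq y)%:~R * `|rho n| * n.*2.+1%:R.
Proof.
move=> rho0; set e := (logn p n`! + n * s)%N.
have x_nint := shift_neq0 p_pr arg_large.
have : (common_den F n)%:R * (denq y)%:~R * rho n \is a Num.int.
  rewrite /residual mulrBr rpredB //.
    have -> : (common_den F n)%:R * (denq y)%:~R * (apery_den x n * y) =
      (common_den F n)%:R * apery_den x n * (numq y)%:~R by rewrite numqE; ring.
    by rewrite rpredM ?intr_int // apery_den_int.
  by rewrite mulrAC rpredM ?intr_int // apery_num_int.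
case/intrP=> m mE.
have c0 : (0 < common_den F n)%N.
  by rewrite muln_gt0 !expn_gt0 lcm_upto_gt0 muln_gt0 expn_gt0 F_gt0 part_gt0.
have m0 : m != 0.
  rewrite -(intr_eq0 rat) -mE !mulf_neq0 // ?intr_eq0 ?denq_neq0 //.
  by rewrite pnatr_eq0 -lt0n.
have := product_formula p_pr m0; rewrite -mE !padic_absM // !normrM.
have -> : `|(common_den F n)%:R| = (common_den F n)%:R :> rat by rewrite ger0_norm.
have -> : `|(denq y)%:~R| = (denq y)%:~R :> rat by rewrite ger0_norm // ler0z denq_ge0.
set A := _ * _ * `|rho n| => h.
have A0 : 0 <= A by rewrite !mulr_ge0 // ler0z denq_ge0.
have hp : padic_abs p (common_den F n)%:R * padic_abs p (denq y)%:~R * padic_abs p (rho n) <=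
    (p ^ (2 * e))%N%:R^-1 * 1 * (n.*2.+1%:R * (p ^ (2 * e))%N%:R^-1).
  apply: ler_pM; rewrite ?mulr_ge0 ?padic_abs_ge0 ?residual_small //.
  by apply: ler_pM; rewrite ?padic_abs_ge0 ?padic_abs_common_den ?padic_abs_int.
have P0 : 0 < (p ^ (4 * e))%N%:R :> rat by rewrite ltr0n expn_gt0 prime_gt0.
have := le_trans h (ler_wpM2l A0 hp).
have -> : A * ((p ^ (2 * e))%N%:R^-1 * 1 * (n.*2.+1%:R * (p ^ (2 * e))%N%:R^-1)) =
   (A * n.*2.+1%:R) / (p ^ (4 * e))%N%:R.
  have -> : (4 * e = 2 * e + 2 * e)%N by lia.
  by rewrite expnD natrM invfM; ring.
by rewrite ler_pdivlMr // mul1r.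
Qed.

Lemma residual_neq0 n : (rho n != 0) || (rho n.+1 != 0).
Proof.
rewrite -negb_and; apply/negP => /andP[/eqP r0 /eqP r1].
have := casoratian (shift_neq0 p_pr arg_large) n.
have -> : apery_den x n * apery_num x n.+1 - apery_den x n.+1 * apery_num x n =
  apery_den x n.+1 * rho n - apery_den x n * rho n.+1 by rewrite /residual; ring.
rewrite r0 r1 !mulr0 subrr => /esym/eqP.
by rewrite mulf_eq0 invr_eq0 expf_eq0 /= (negPf (nat1_neq0 n)).
Qed.

Variable R : realType.

Lemma residual_growth (e : R) : 0 < e ->
  exists2 C : R, 0 < C & forall n, `|ratr (rho n)| <= C * (1 + e) ^+ n.
Proof.
move=> e0; apply: (@apery_growth R (ratr (x * (1 - x))) (fun n => ratr (rho n))) => // n.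
have E : apery_op x rho n = 0.
  transitivity (y * apery_op x (apery_den x) n - apery_op x (apery_num x) n).
    by rewrite /apery_op /residual; ring.
  rewrite apery_den_rec apery_num_rec ?mulr0 ?subr0 //; exact: (shift_neq0 p_pr arg_large).
have := congr1 (@ratr R) E; rewrite rmorph0 => <-; rewrite /apery_op.
by rewrite !(rmorphD, rmorphN, rmorphXn, rmorphM, rmorph_nat, rmorph1).
Qed.

(** The logarithm of the lower bound, with the denominators made explicit. *)
Lemma residual_ln n : rho n != 0 ->
  4 * ((logn p n`!)%:R + n%:R * s%:R) * ln p%:R <=
  3 * ln (lcm_upto n)%:R + 2 * (n%:R * ln F%:R + \sum_(q <- primes F) (logn q n`!)%:R * ln q%:R)
  + ln (denq y)%:~R + ln `|ratr (rho n)| + ln n.*2.+1%:R :> R.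
Proof.
move=> r0; have := residual_lower r0; rewrite -(ler_rat R).
rewrite 3!rmorphM /= !rmorph_nat rmorph_int ratr_norm.
have z0 : 0 < `|ratr (rho n)| :> R by rewrite normr_gt0 fmorph_eq0.
move: `|_| z0 => z z0.
have v0 : 0 < (denq y)%:~R :> R by rewrite ltr0z denq_gt0.
have d0 := lcm_upto_gt0 n.
have part0 : (0 < n`!`_\pi(F))%N by rewrite part_gt0.
have mu0 : (0 < prog_den F n)%N by rewrite muln_gt0 expn_gt0 F_gt0.
have c0 : (0 < common_den F n)%N by rewrite muln_gt0 !expn_gt0 d0 mu0.
have p0 := prime_gt0 p_pr.
have c0R : 0 < (common_den F n)%:R :> R by rewrite ltr0n.
have l0R : 0 < n.*2.+1%:R :> R by rewrite ltr0n.
have pe0 : 0 < (p ^ (4 * (logn p n`! + n * s)))%N%:R :> R by rewrite ltr0n expn_gt0 p0.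
move=> h; have {h} : ln (p ^ (4 * (logn p n`! + n * s)))%N%:R <=
    ln (common_den F n)%:R + ln (denq y)%:~R + ln z + ln n.*2.+1%:R :> R.
  rewrite -(lnM c0R v0) -(lnM (mulr_gt0 c0R v0) z0).
  by rewrite -(lnM (mulr_gt0 (mulr_gt0 c0R v0) z0) l0R) ler_ln ?posrE // !mulr_gt0.
have -> : ln (p ^ (4 * (logn p n`! + n * s)))%N%:R =
    4 * ((logn p n`!)%:R + n%:R * s%:R) * ln p%:R :> R.
  by rewrite natrX lnXn ?ltr0n // -[LHS]mulr_natl natrM natrD natrM.
have -> : ln (common_den F n)%:R = 3 * ln (lcm_upto n)%:R + 2 * ln (prog_den F n)%:R :> R.
  by rewrite lnM_nat ?expn_gt0 ?d0 ?mu0 // !natrX !lnXn ?ltr0n // !mulr_natl.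
have -> : ln (prog_den F n)%:R = n%:R * ln F%:R + ln (n`!`_\pi(F))%:R :> R.
  by rewrite lnM_nat ?expn_gt0 ?F_gt0 // natrX lnXn ?ltr0n // mulr_natl.
rewrite partn_primes ?fact_gt0 // ln_prod_nat; last first.
  by move=> q; rewrite mem_primes expn_gt0 => /and3P[/prime_gt0 -> _ _].
rewrite (_ : \sum_(q <- primes F) ln (q ^ logn q n`!)%N%:R =
   \sum_(q <- primes F) (logn q n`!)%:R * ln q%:R :> R); last first.
  apply: eq_big_seq => q; rewrite mem_primes => /and3P[/prime_gt0 q0 _ _].
  by rewrite natrX lnXn ?ltr0n // mulr_natl.
by rewrite [2 * (_ + _)]mulrDr; lra.
Qed.

End Rational.
End Irrationality.

Section LogBounds.
Variable R : realType.

Lemma logn_fact_ln_lower p n : prime p ->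
  n%:R * (ln p%:R / (p%:R - 1)) <= (logn p n`!)%:R * ln p%:R + ln n.+1%:R + ln p%:R :> R.
Proof.
move=> p_pr; have p1 := prime_gt1 p_pr.
have P0 : 0 <= ln p%:R :> R := ln_nat_ge0 R p.
have [->|n0] := posnP n; first by rewrite mul0r !addr_ge0 ?mulr_ge0 ?ln_nat_ge0.
have pm : p%:R - 1 = p.-1%:R :> R by rewrite -subn1 natrB ?prime_gt0.
have pm0 : 0 < p%:R - 1 :> R by rewrite subr_gt0 ltr1n.
have h : n%:R <= (p%:R - 1) * ((logn p n`!)%:R + (trunc_log p n)%:R + 1) :> R.
  by rewrite pm -natrD natr1 -natrM ler_nat -addn1 logn_fact_lower.
have hK : (trunc_log p n)%:R * ln p%:R <= ln n.+1%:R :> R.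
  rewrite mulr_natl -lnXn ?ltr0n ?prime_gt0 // -natrX ler_ln_nat // expn_gt0 prime_gt0 //=.
  by apply: leqW; apply: trunc_logP.
rewrite mulrA ler_pdivrMr //.
have := ler_wpM2r P0 h; move: (_ - 1) pm0 hK => q q0 hK h1.
by apply: le_trans h1 _; rewrite -mulrA mulrC ler_wpM2r ?(ltW q0) // !mulrDl mul1r !lerD.
Qed.

Lemma sum_logn_fact_ln F n :
  \sum_(q <- primes F) (logn q n`!)%:R * ln q%:R <=
  n%:R * \sum_(q <- primes F) ln q%:R / (q%:R - 1) :> R.
Proof.
rewrite mulr_sumr big_seq [leRHS]big_seq; apply: ler_sum => q.
rewrite mem_primes => /andP[q_pr _].
have qm0 : 0 < q%:R - 1 :> R by rewrite subr_gt0 ltr1n prime_gt1.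
have qm : q%:R - 1 = q.-1%:R :> R by rewrite -subn1 natrB ?prime_gt0.
rewrite mulrCA mulrC ler_wpM2l ?ln_nat_ge0 // ler_pdivlMr //.
by rewrite qm -natrM ler_nat mulnC logn_fact_upper.
Qed.

End LogBounds.

Theorem theorem11p2 (R : realType) (p : nat) (p_pr : prime p) (a : int)
  (F : nat) (r : int)
  (a_ndvd : ~~ (p%:Z %| a)%Z)
  (F_gt0 : (0 < F)%N) (pF : (p %| F)%N)
  (r_def : padic_norm (F%:R : padic p_pr) = p%:R ^ (- r))
  (F_bound : ln F%:R + \sum_(q <- primes F) ln q%:R / (q%:R - 1) + 3 / 2
             < 2 * r%:~R * ln p%:R + 2 * (ln p%:R / (p%:R - 1)) :> R) :
  ~ exists x : rat, Tp p_pr a F = ratr x.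
Proof.
move=> [y Ty]; have p1 := prime_gt1 p_pr.
have rE : r = logn p F.
  have FE : (F%:R : padic p_pr) = ratr F%:R by rewrite -padic_of_ratE rmorph_nat.
  move: r_def; rewrite FE padic_norm_ratr padic_abs_natE // natrX exprnN => E.
  have p0 : 0 < p%:R :> rat by rewrite ltr0n prime_gt0.
  have pn1 : p%:R != 1 :> rat by rewrite pnatr_eq1 gtn_eqF.
  by have /oppr_inj := ieexprIz p0 pn1 E.
move: F_bound; rewrite {}rE /=.
set S := \sum_(q <- _) _; set P := ln p%:R; set Q := P / _; set Fl := ln F%:R.
set s := (logn p F)%:~R; move=> bound.
pose d := 2 * s * P + 2 * Q - (Fl + S + 3 / 2).
have d0 : 0 < d by rewrite subr_gt0.
(* the nine error terms e m below add up to d m, half of the gap 2 d m *)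
pose e := d / 9; have e0 : 0 < e by rewrite divr_gt0.
have [C C0 growth] := residual_growth p_pr a_ndvd F_gt0 pF y e0.
have [C1 sublin] := ln_sublinear_nat e0.
pose K := 3 + 3 * e + ln (denq y)%:~R + ln C + ln 2 + 5 * C1 + 4 * P.
have [n0 n0N d_small] := lcm_upto_small (Num.truncn (K / d)).+2 e0.
(* the lcm bound at n0 still serves at n0 - 1 *)
have [m [mn nm rho0]] : exists m, [/\ (m <= n0)%N, (n0 <= m.+1)%N &
    residual (a%:~R / F%:R) y m != 0].
  case: n0 n0N {d_small} => // n _.
  have /orP[h|h] := residual_neq0 p_pr a_ndvd F_gt0 pF y n; first by exists n.
  by exists n.+1.
have h1 := residual_ln a_ndvd F_gt0 pF Ty R rho0.
have h2 := sum_logn_fact_ln R F m.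
have h3 : ln (lcm_upto m)%:R <= (1 + e) * (m%:R + 1).
  apply: le_trans (le_trans d_small _).
    by rewrite ler_ln_nat // lcm_upto_gt0 leq_lcm_upto.
  by rewrite ler_pM2l ?addr_gt0 // natr1 ler_nat.
have h4 : ln `|ratr (residual (a%:~R / F%:R) y m)| <= ln C + m%:R * e.
  have e1 : 0 < 1 + e by rewrite addr_gt0.
  apply: (@le_trans _ _ (ln (C * (1 + e) ^+ m))).
    by rewrite ler_ln ?posrE ?mulr_gt0 ?exprn_gt0 ?normr_gt0 ?fmorph_eq0.
  rewrite lnM ?posrE ?exprn_gt0 // lnXn // lerD2l -[leLHS]mulr_natl ler_wpM2l //.
  by rewrite le_ln1Dx // (lt_trans _ e0) ?ltrN10.
have h5 : ln m.*2.+1%:R <= ln 2 + (e * m%:R + C1).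
  apply: le_trans (lerD (lexx _) (sublin m)).
  rewrite -lnM_nat // ler_ln_nat //= -mul2n; lia.
have h6 := logn_fact_ln_lower R m p_pr.
have h7 := sublin m.
have Mbig : K < d * m%:R.
  rewrite mulrC -ltr_pdivrMr //; apply: lt_le_trans (truncnS_gt _) _.
  by rewrite ler_nat -ltnS (leq_trans n0N).
move: Mbig; rewrite ltNge => /negP; apply.
rewrite -/S -/P -/Q -/Fl in h1 h2 h6.
have hd : m%:R * d = 2 * (m%:R * s * P) + 2 * (m%:R * Q) - m%:R * Fl - m%:R * S - 3 / 2 * m%:R.
  by rewrite /d; ring.
have he : m%:R * d = 9 * (m%:R * e) by rewrite /e; field.
rewrite /K; move: h1 h2 h3 h4 h5 h6 h7.
have -> : (1 + e) * (m%:R + 1) = m%:R + 1 + m%:R * e + e by ring.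
have -> : 4 * ((logn p m`!)%:R + m%:R * (logn p F)%:R) * P =
   4 * ((logn p m`!)%:R * P) + 4 * (m%:R * s * P) by rewrite /s; ring.
rewrite [e * _]mulrC [d * _]mulrC.
lra.
Qed.
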